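(* Let $\mathbb{T}^2=[0,1]^2$ be the two-dimensional torus and let $u\in C^\infty(\mathbb{T}^2)$ be the cellular flow $$u(x)=\nabla^{\perp}\big(\sin(2\pi x_1)\sin(2\pi x_2)\big),\qquad \nabla^\perp=(-\partial_{x_2},\partial_{x_1}).$$ Fix $\gamma>0$ and $\alpha\geq 1$. Then for any $\epsilon>0$ there exists $m_0>0$ such that for any $m\geq m_0$ there exists $A_0>0$ such that $$\tau_{\alpha}^{*}\big(A\,u(m\,\cdot),\gamma\big)\leq \epsilon\qquad\text{for all } A\geq A_0 .$$
   Context: Let $L^2_0$ denote the subspace of mean-zero functions in $L^2(\mathbb{T}^d)$. For a divergence-free velocity field $v$ on $\mathbb{T}^d$ and $\alpha,\gamma>0$, consider the advection (hyper/fractional) diffusion equation $$\partial_t\theta+v\cdot\nabla\theta+\gamma(-\Delta)^{\alpha}\theta=0\quad\text{on }(0,\infty)\times\mathbb{T}^d .$$ Let $\mathcal{S}^{v,\alpha}_{s,t}$ denote its solution operator: for $\theta_s\in L^2_0$, $\mathcal{S}^{v,\alpha}_{s,t}\theta_s$ is the solution at time $t$ with data $\theta(s,\cdot)=\theta_s$. The dissipation time of $v$ is $$\tau^*_\alpha(v,\gamma)=\inf\Big\{t\geq 0:\ \big\|\mathcal{S}^{v,\alpha}_{s,s+t}\big\|_{L^2_0\to L^2_0}\leq \tfrac12\ \text{for all } s\geq 0\Big\}.$$ Here $u(m\,\cdot)$ denotes the field $x\mapsto u(mx)$. *)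

(* Defs.v *)
From Stdlib Require Import Reals Lra ZArith List.
From Coquelicot Require Import Coquelicot.
Import ListNotations.
Open Scope R_scope.

(* Functions on T^2 = [0,1]^2 are represented through their Fourier           *)
(* coefficients  f : Z*Z -> C  (f(x) = sum_k f_k e^{2 pi i k.x}).  By          *)
(* Parseval, the L^2(T^2) norm is the l^2(Z^2) norm of the coefficients.       *)

Definition mode := (Z * Z)%type.

Definition zrange (N : nat) : list Z :=
  map (fun i => (Z.of_nat i - Z.of_nat N)%Z) (seq 0 (2 * N + 1)).

Definition box (N : nat) : list mode := list_prod (zrange N) (zrange N).

Definition boxsum (N : nat) (g : mode -> R) : R :=
  fold_right Rplus 0 (map g (box N)).

(* sum over Z^2 of a nonnegative family (supremum of the box partial sums) *)
Definition tsum (g : mode -> R) : Rbar :=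
  Lub_Rbar (fun r => exists N, r = boxsum N g).

Definition norm2 (f : mode -> C) : Rbar := tsum (fun k => Cmod (f k) ^ 2).

Definition hnorm2 (n : nat) (f : mode -> C) : Rbar :=
  tsum (fun k => (1 + IZR (fst k) ^ 2 + IZR (snd k) ^ 2) ^ n * Cmod (f k) ^ 2).

Definition Csub (f g : mode -> C) : mode -> C := fun k => Cminus (f k) (g k).

(* the (real-valued, mean zero) L^2 functions: L^2_0(T^2) *)
Definition L2_0 (f : mode -> C) : Prop :=
  is_finite (norm2 f) /\
  f (0, 0)%Z = RtoC 0 /\
  (forall k : mode, f (- fst k, - snd k)%Z = Cconj (f k)).

(* Fourier symbol of (-Delta)^alpha on T^2:  |2 pi k|^{2 alpha} *)
Definition frac_symbol (alpha : R) (k : mode) : R :=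
  if (Z.eqb (fst k) 0 && Z.eqb (snd k) 0)%bool then 0
  else Rpower (4 * PI ^ 2 * (IZR (fst k) ^ 2 + IZR (snd k) ^ 2)) alpha.

(* A velocity field given by finitely many Fourier modes:
   v(x) = sum_{(j,(a,b)) in v} (a,b) e^{2 pi i j.x}  (modes listed once). *)
Definition vfield := list (mode * (C * C)).

(* Fourier coefficients of v . grad f at mode k:
   sum_j vhat_j . (2 pi i (k-j)) fhat_{k-j} *)
Definition advect (v : vfield) (f : mode -> C) (k : mode) : C :=
  fold_right Cplus (RtoC 0)
    (map (fun jab : mode * (C * C) =>
            let j := fst jab in
            let a := fst (snd jab) in
            let b := snd (snd jab) in
            let d1 := IZR (fst k - fst j) in
            let d2 := IZR (snd k - snd j) in
            Cmult (Cplus (Cmult a (0, 2 * PI * d1)) (Cmult b (0, 2 * PI * d2)))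
                  (f (fst k - fst j, snd k - snd j)%Z))
         v).

(* Fourier coefficients of x |-> A * u(m x), where
   u = grad^perp (sin(2 pi x1) sin(2 pi x2)), i.e.
   u1(x) = -2 pi sin(2 pi x1) cos(2 pi x2),  u2(x) = 2 pi cos(2 pi x1) sin(2 pi x2).
   A u(m x) = sum_{s in {+-1}^2} (i pi A s1/2, -i pi A s2/2) e^{2 pi i m s.x}. *)
Definition cellular_hat (A : R) (m : nat) : vfield :=
  map (fun s : Z * Z =>
         ((Z.of_nat m * fst s, Z.of_nat m * snd s)%Z,
          ((0, PI * A * IZR (fst s) / 2), (0, - (PI * A * IZR (snd s) / 2)))))
      [(1, 1); (1, -1); (-1, 1); (-1, -1)]%Z.

(* theta is a solution on [s, oo) of
     d_t theta + v . grad theta + gamma (-Delta)^alpha theta = 0,  theta(s) = th0,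
   in the class of solutions that are continuous into L^2 at time s and
   smooth (locally uniformly bounded in every H^n) for t > s, the equation
   holding mode by mode for t > s.  For smooth v and L^2 data the solution
   exists and is unique in this class. *)
Definition is_solution (v : vfield) (alpha gamma : R) (s : R)
    (th0 : mode -> C) (theta : R -> mode -> C) : Prop :=
  theta s = th0 /\
  (forall eps, 0 < eps -> exists delta, 0 < delta /\
      forall t, s < t < s + delta -> Rbar_le (norm2 (Csub (theta t) th0)) eps) /\
  (forall a b, s < a -> a <= b -> forall n : nat, exists Cst : R,
      forall t, a <= t <= b -> Rbar_le (hnorm2 n (theta t)) Cst) /\
  (forall t, s < t -> forall k : mode,
      let rhs := Copp (Cplus (Cmult (RtoC (gamma * frac_symbol alpha k)) (theta t k))
                             (advect v (theta t) k)) in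
      derivable_pt_lim (fun tau => fst (theta tau k)) t (fst rhs) /\
      derivable_pt_lim (fun tau => snd (theta tau k)) t (snd rhs)).

(* || S^{v,alpha}_{s,s+t} ||_{L^2_0 -> L^2_0} <= 1/2  for all s >= 0 *)
Definition half_contracting (v : vfield) (alpha gamma t : R) : Prop :=
  forall s, 0 <= s -> forall th0 theta, L2_0 th0 -> is_solution v alpha gamma s th0 theta ->
    Rbar_le (norm2 (theta (s + t))) (Rbar_mult (/ 4) (norm2 th0)).

(* dissipation time tau*_alpha(v, gamma)  (inf of the empty set = +oo) *)
Definition tau_star (v : vfield) (alpha gamma : R) : Rbar :=
  Glb_Rbar (fun t => 0 <= t /\ half_contracting v alpha gamma t).

(* Main.v *)
(* The Fourier coefficients evolve by a real linear system, so the real and the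
   imaginary part can be treated separately.  By the energy balance, the norm at
   the end of a time interval is small if the time integral of the energy E is
   small compared with that of the dissipation G >= sum |k|^2 |theta_k|^2.  Modes
   with |k| >= m/2 satisfy this with a factor 1/m^2.  A nonzero low mode
   k = (k1, k2), say with k1 <> 0, is the trace T(k1) of theta on the separatrix
   {x2 = 0} (the sum of theta over k1 x (k2 + m Z)) minus high modes, and these
   cost another factor 1/m by Cauchy-Schwarz.

   It remains to see that T becomes negligible as A grows.  On the separatrix the
   flow reduces to a one-dimensional one: with p_i = k1 + m i and S_i = p_i T_i,
   T_i' = 2 pi^2 A (S_(i-1) - S_(i+1)) up to terms that are of lower order in A or
   small when the trace is cut off far away.  Here p_i never vanishes.  Averaging
   d/dt (S_i S_(i+1)) over time shows that the average of |S_0|^2 is bounded by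
   that of |S_N|^2 at every N on one side.  But G controls sum_i |S_i|^2 / |p_i|,
   the H^(1/2) norm of the trace, and the harmonic series diverges, so the average
   of |S_0|^2 must be small. *)

Require Import Defs.
From Stdlib Require Import Reals Lra Lia Psatz ZArith List Permutation FinFun.
From Coquelicot Require Import Coquelicot.
Import ListNotations.
Open Scope R_scope.

(** * Finite sums *)

Definition lsum {T : Type} (l : list T) (f : T -> R) : R :=
  fold_right Rplus 0 (map f l).

Lemma lsum_nil {T : Type} (f : T -> R) : lsum nil f = 0.
Proof. reflexivity. Qed.

Lemma lsum_cons {T : Type} (a : T) (l : list T) (f : T -> R) :
  lsum (a :: l) f = f a + lsum l f.
Proof. reflexivity. Qed.

Lemma lsum_ext {T : Type} (l : list T) (f g : T -> R) :
  (forall a, In a l -> f a = g a) -> lsum l f = lsum l g.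
Proof.
  induction l as [|a l IH]; intros H; [reflexivity|].
  rewrite !lsum_cons, H by now left.
  f_equal; apply IH; intros; apply H; now right.
Qed.

Lemma lsum_le {T : Type} (l : list T) (f g : T -> R) :
  (forall a, In a l -> f a <= g a) -> lsum l f <= lsum l g.
Proof.
  induction l as [|a l IH]; intros H; [apply Rle_refl|].
  rewrite !lsum_cons; apply Rplus_le_compat; [apply H; now left|].
  apply IH; intros; apply H; now right.
Qed.

Lemma lsum_const {T : Type} (l : list T) (c : R) :
  lsum l (fun _ => c) = INR (length l) * c.
Proof.
  induction l as [|a l IH]; [rewrite lsum_nil; cbn [length INR]; ring|].
  rewrite lsum_cons, IH; cbn [length]; rewrite S_INR; ring.
Qed.

Lemma lsum_nonneg {T : Type} (l : list T) (f : T -> R) :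
  (forall a, In a l -> 0 <= f a) -> 0 <= lsum l f.
Proof.
  intros H; apply Rle_trans with (lsum l (fun _ => 0)); [rewrite lsum_const; lra|].
  now apply lsum_le.
Qed.

Lemma lsum_plus {T : Type} (l : list T) (f g : T -> R) :
  lsum l (fun a => f a + g a) = lsum l f + lsum l g.
Proof.
  induction l as [|a l IH]; [rewrite !lsum_nil; ring|]; rewrite !lsum_cons, IH; ring.
Qed.

Lemma lsum_scal {T : Type} (l : list T) (c : R) (f : T -> R) :
  lsum l (fun a => c * f a) = c * lsum l f.
Proof.
  induction l as [|a l IH]; [rewrite !lsum_nil; ring|]; rewrite !lsum_cons, IH; ring.
Qed.

Lemma lsum_minus {T : Type} (l : list T) (f g : T -> R) :
  lsum l (fun a => f a - g a) = lsum l f - lsum l g.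
Proof.
  induction l as [|a l IH]; [rewrite !lsum_nil; ring|]; rewrite !lsum_cons, IH; ring.
Qed.

Lemma lsum_app {T : Type} (l l' : list T) (f : T -> R) :
  lsum (l ++ l') f = lsum l f + lsum l' f.
Proof.
  induction l as [|a l IH]; [rewrite lsum_nil; cbn [app]; ring|].
  rewrite <- app_comm_cons, !lsum_cons, IH; ring.
Qed.

Lemma lsum_map {T U : Type} (h : T -> U) (l : list T) (f : U -> R) :
  lsum (map h l) f = lsum l (fun a => f (h a)).
Proof. unfold lsum; now rewrite map_map. Qed.

Lemma lsum_prod {T U : Type} (l : list T) (l' : list U) (f : T * U -> R) :
  lsum (list_prod l l') f = lsum l (fun a => lsum l' (fun b => f (a, b))).
Proof.
  induction l as [|a l IH]; [reflexivity|].
  cbn [list_prod]; now rewrite lsum_app, lsum_map, lsum_cons, IH.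
Qed.

Lemma lsum_perm {T : Type} (l l' : list T) (f : T -> R) :
  Permutation l l' -> lsum l f = lsum l' f.
Proof.
  induction 1; rewrite ?lsum_cons; try lra; try reflexivity.
Qed.

Lemma lsum_abs {T : Type} (l : list T) (f : T -> R) :
  Rabs (lsum l f) <= lsum l (fun a => Rabs (f a)).
Proof.
  induction l as [|a l IH]; [rewrite !lsum_nil, Rabs_R0; lra|].
  rewrite !lsum_cons; apply Rle_trans with (1 := Rabs_triang _ _); lra.
Qed.

Lemma lsum_elem_le {T : Type} (l : list T) (f : T -> R) (a : T) :
  (forall b, In b l -> 0 <= f b) -> In a l -> f a <= lsum l f.
Proof.
  intros H Ha; apply in_split in Ha as (l1 & l2 & ->).
  rewrite lsum_app, lsum_cons.
  assert (0 <= lsum l1 f) by (apply lsum_nonneg; intros; apply H, in_or_app; now left).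
  assert (0 <= lsum l2 f)
    by (apply lsum_nonneg; intros; apply H, in_or_app; right; now right).
  lra.
Qed.

Lemma lsum_filter {T : Type} (p : T -> bool) (l : list T) (f : T -> R) :
  lsum (filter p l) f = lsum l (fun a => if p a then f a else 0).
Proof.
  induction l as [|a l IH]; [reflexivity|]; cbn [filter]; rewrite lsum_cons, <- IH.
  destruct (p a); [now rewrite lsum_cons|ring].
Qed.

Lemma lsum_incl_le {T : Type} (l l' : list T) (f : T -> R) :
  NoDup l -> incl l l' -> (forall a, 0 <= f a) -> lsum l f <= lsum l' f.
Proof.
  revert l'; induction l as [|a l IH]; intros l' Hnd Hin Hf.
  - now apply lsum_nonneg.
  - inversion_clear Hnd as [|? ? Hna Hnd'].
    destruct (in_split a l') as (l1 & l2 & ->); [apply Hin; now left|].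
    rewrite (lsum_perm (l1 ++ a :: l2) (a :: l1 ++ l2))
      by (symmetry; apply Permutation_middle).
    rewrite !lsum_cons; apply Rplus_le_compat_l, IH; auto.
    intros b Hb; assert (Hb' : In b (l1 ++ a :: l2)) by (apply Hin; now right).
    apply in_app_or in Hb' as [|[<-|]]; [apply in_or_app; now left| |].
    + contradiction.
    + apply in_or_app; now right.
Qed.

Lemma lsum_inj_le {T U : Type} (h : T -> U) (l : list T) (l' : list U) (f : U -> R) :
  NoDup l -> Injective h -> (forall a, In a l -> In (h a) l') -> (forall b, 0 <= f b) ->
  lsum l (fun a => f (h a)) <= lsum l' f.
Proof.
  intros Hnd Hinj Hin Hf; rewrite <- lsum_map; apply lsum_incl_le; auto.
  - now apply Injective_map_NoDup.
  - intros b Hb; apply in_map_iff in Hb as (a & <- & Ha); auto.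
Qed.

Lemma lsum_supp {T : Type} (l l' : list T) (f : T -> R) :
  NoDup l -> NoDup l' -> (forall a, f a <> 0 -> (In a l <-> In a l')) ->
  lsum l f = lsum l' f.
Proof.
  intros Hl Hl' H.
  set (p := fun a => if Req_EM_T (f a) 0 then false else true).
  assert (Hp : forall k : list T, lsum k f = lsum (filter p k) f).
  { intros k; rewrite lsum_filter; apply lsum_ext; intros a _.
    unfold p; destruct (Req_EM_T (f a) 0); auto. }
  rewrite (Hp l), (Hp l'); apply lsum_perm, NoDup_Permutation;
    try now apply NoDup_filter.
  intros a; rewrite !filter_In; unfold p; destruct (Req_EM_T (f a) 0) as [|Hfa].
  - split; intros [_ ?]; discriminate.
  - specialize (H a Hfa); tauto.
Qed.

Lemma lsum_cauchy {T : Type} (l : list T) (f g : T -> R) :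
  (lsum l (fun a => f a * g a)) ^ 2 <=
  lsum l (fun a => f a ^ 2) * lsum l (fun a => g a ^ 2).
Proof.
  induction l as [|a l IH]; [rewrite !lsum_nil; lra|]; rewrite !lsum_cons.
  set (F := lsum l (fun a => f a ^ 2)) in *; set (G := lsum l (fun a => g a ^ 2)) in *.
  set (H := lsum l (fun a => f a * g a)) in *.
  assert (HF : 0 <= F) by (apply lsum_nonneg; intros; apply pow2_ge_0).
  assert (HG : 0 <= G) by (apply lsum_nonneg; intros; apply pow2_ge_0).
  set (x := f a); set (y := g a).
  enough (2 * (x * y) * H <= x ^ 2 * G + y ^ 2 * F) by nra.
  (* both squares: |2xyH| <= 2|x||y| sqrt(F G) <= x^2 G + y^2 F *)
  assert (H1 : (2 * (x * y) * H) ^ 2 <= (x ^ 2 * G + y ^ 2 * F) ^ 2).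
  { assert (0 <= (x ^ 2 * G - y ^ 2 * F) ^ 2) by apply pow2_ge_0.
    assert (0 <= (x * y) ^ 2) by apply pow2_ge_0.
    nra. }
  apply Rsqr_incr_0_var; [unfold Rsqr; nra|].
  apply Rplus_le_le_0_compat; apply Rmult_le_pos; auto; apply pow2_ge_0.
Qed.

Lemma lsum_sqr_le {T : Type} (l : list T) (f : T -> R) :
  (lsum l f) ^ 2 <= INR (length l) * lsum l (fun a => f a ^ 2).
Proof.
  assert (H := lsum_cauchy l (fun _ => 1) f); cbn beta in H.
  rewrite (lsum_ext l (fun a => 1 * f a) f) in H by (intros; ring).
  rewrite (lsum_const l (1 ^ 2)) in H; rewrite pow1, Rmult_1_r in H; exact H.
Qed.

Lemma in_zrange (N : nat) (i : Z) :
  In i (zrange N) <-> (- Z.of_nat N <= i <= Z.of_nat N)%Z.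
Proof.
  unfold zrange; rewrite in_map_iff; split.
  - intros (n & <- & Hn); apply in_seq in Hn; lia.
  - intros H; exists (Z.to_nat (i + Z.of_nat N)); split; [lia|].
    apply in_seq; lia.
Qed.

Lemma NoDup_zrange (N : nat) : NoDup (zrange N).
Proof.
  unfold zrange; apply Injective_map_NoDup; [intros a b H; lia|apply seq_NoDup].
Qed.

Lemma length_zrange (N : nat) : length (zrange N) = (2 * N + 1)%nat.
Proof. unfold zrange; now rewrite length_map, length_seq. Qed.

Lemma in_box (N : nat) (k : mode) :
  In k (box N) <-> (- Z.of_nat N <= fst k <= Z.of_nat N)%Z /\
                   (- Z.of_nat N <= snd k <= Z.of_nat N)%Z.
Proof.
  destruct k as [k1 k2]; unfold box, mode; rewrite in_prod_iff, !in_zrange; reflexivity.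
Qed.

Lemma NoDup_list_prod {T U : Type} (l : list T) (l' : list U) :
  NoDup l -> NoDup l' -> NoDup (list_prod l l').
Proof.
  intros Hl Hl'; induction Hl as [|a l Ha Hl IH]; [constructor|]; cbn [list_prod].
  apply NoDup_app; auto.
  - apply Injective_map_NoDup; auto; intros b c H; now inversion H.
  - intros [b c] Hb Hc; apply in_map_iff in Hb as (d & Hd & _); inversion Hd; subst.
    apply in_prod_iff in Hc; tauto.
Qed.

Lemma NoDup_box (N : nat) : NoDup (box N).
Proof. apply NoDup_list_prod; apply NoDup_zrange. Qed.

Lemma boxsum_lsum (N : nat) (g : mode -> R) : boxsum N g = lsum (box N) g.
Proof. reflexivity. Qed.

Lemma lsum_box_mono (N M : nat) (g : mode -> R) :
  (N <= M)%nat -> (forall k, 0 <= g k) -> lsum (box N) g <= lsum (box M) g.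
Proof.
  intros H Hg; apply lsum_incl_le; auto using NoDup_box.
  intros k; rewrite !in_box; lia.
Qed.

Lemma lsum_zrange_shift (N : nat) (c : Z) (f : Z -> R) :
  (forall i, f i <> 0 -> In i (zrange N) /\ In (i - c)%Z (zrange N)) ->
  lsum (zrange N) (fun i => f (i + c)%Z) = lsum (zrange N) f.
Proof.
  intros H; rewrite <- (lsum_map (fun i => (i + c)%Z)).
  apply lsum_supp.
  - apply Injective_map_NoDup; [intros a b; lia|apply NoDup_zrange].
  - apply NoDup_zrange.
  - intros a Ha; specialize (H a Ha); split; [tauto|].
    intros _; apply in_map_iff; exists (a - c)%Z; split; [lia|tauto].
Qed.

Lemma lsum_box_shift (N : nat) (c d : Z) (f : mode -> R) :
  (forall k, f k <> 0 -> In k (box N) /\ In (fst k - c, snd k - d)%Z (box N)) ->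
  lsum (box N) (fun k => f (fst k + c, snd k + d)%Z) = lsum (box N) f.
Proof.
  intros H; rewrite <- (lsum_map (fun k : mode => (fst k + c, snd k + d)%Z)).
  apply lsum_supp.
  - apply Injective_map_NoDup; [|apply NoDup_box].
    intros [a b] [a' b'] E; cbn in E; inversion E; f_equal; lia.
  - apply NoDup_box.
  - intros a Ha; specialize (H a Ha); split; [tauto|].
    intros _; apply in_map_iff; exists (fst a - c, snd a - d)%Z; split; [|tauto].
    destruct a; cbn; f_equal; lia.
Qed.

(** * The energy flux through a large box *)

Lemma mode_eq_dec (k l : mode) : {k = l} + {k <> l}.
Proof. decide equality; apply Z.eq_dec. Qed.

Definition sq (k : mode) : R := IZR (fst k) ^ 2 + IZR (snd k) ^ 2.

Lemma sq_nonneg (k : mode) : 0 <= sq k.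
Proof. unfold sq; nra. Qed.

(* The Fourier symbol of [- v . grad], for the cellular flow of frequency [m],
   divided by the amplitude [PI ^ 2 * A].  Its coefficients are real. *)
Definition adv (m : Z) (x : mode -> R) (k : mode) : R :=
  (IZR (fst k) - IZR (snd k)) * x (fst k - m, snd k - m)%Z
  + (IZR (fst k) + IZR (snd k)) * x (fst k - m, snd k + m)%Z
  - (IZR (fst k) + IZR (snd k)) * x (fst k + m, snd k - m)%Z
  - (IZR (fst k) - IZR (snd k)) * x (fst k + m, snd k + m)%Z.

Lemma adv_skew (N : nat) (m : Z) (y : mode -> R) :
  (forall k, y k <> 0 -> In k (box N)) ->
  lsum (box N) (fun k => y k * adv m y k) = 0.
Proof.
  intros Hy.
  assert (H1 := lsum_box_shift N m m
    (fun k => (IZR (fst k) - IZR (snd k)) * (y k * y (fst k - m, snd k - m)%Z))).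
  assert (H2 := lsum_box_shift N m (- m)
    (fun k => (IZR (fst k) + IZR (snd k)) * (y k * y (fst k - m, snd k + m)%Z))).
  cbn [fst snd] in H1, H2.
  rewrite (lsum_ext (T := mode) _ _ (fun k : mode =>
      ((IZR (fst k) - IZR (snd k)) * (y k * y (fst k - m, snd k - m)%Z)
       - (IZR (fst k + m) - IZR (snd k + m)) *
           (y (fst k + m, snd k + m)%Z * y (fst k + m - m, snd k + m - m)%Z))
      + ((IZR (fst k) + IZR (snd k)) * (y k * y (fst k - m, snd k + m)%Z)
       - (IZR (fst k + m) + IZR (snd k + - m)) *
           (y (fst k + m, snd k + - m)%Z * y (fst k + m - m, snd k + - m + m)%Z)))).
  - rewrite lsum_plus, !lsum_minus, H1, H2; [ring| |].
    + intros k Hk; split; [apply Hy|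
        replace (snd k - - m)%Z with (snd k + m)%Z by lia; apply Hy];
        intros E; apply Hk; rewrite E; ring.
    + intros k Hk; split; apply Hy; intros E; apply Hk; rewrite E; ring.
  - intros [k1 k2] _; unfold adv; cbn [fst snd].
    replace (k1 + m - m)%Z with k1 by lia; replace (k2 + m - m)%Z with k2 by lia.
    replace (k2 + - m + m)%Z with k2 by lia; replace (k2 + - m)%Z with (k2 - m)%Z by lia.
    rewrite !plus_IZR, !minus_IZR; ring.
Qed.

Lemma IZR_bound (a : Z) (N : nat) :
  (- Z.of_nat N <= a <= Z.of_nat N)%Z -> - INR N <= IZR a <= INR N.
Proof.
  intros [H1 H2]; rewrite INR_IZR_INZ; split; [rewrite <- opp_IZR|]; now apply IZR_le.
Qed.

Lemma sq_out_box (k : mode) (N : nat) : ~ In k (box N) -> INR N ^ 2 <= sq k.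
Proof.
  rewrite in_box; intros H; unfold sq; rewrite INR_IZR_INZ.
  assert (HN : 0 <= IZR (Z.of_nat N)) by (apply IZR_le; lia).
  assert (H' : (fst k <= - Z.of_nat N \/ Z.of_nat N <= fst k \/
                snd k <= - Z.of_nat N \/ Z.of_nat N <= snd k)%Z) by lia.
  destruct H' as [E|[E|[E|E]]]; apply IZR_le in E; rewrite ?opp_IZR in E; nra.
Qed.

Lemma flux_term (N m : nat) (c d : Z) (x z co : mode -> R) (Cst : R) :
  (0 < N)%nat -> (2 * m <= N)%nat -> (Z.abs c <= Z.of_nat m)%Z -> (Z.abs d <= Z.of_nat m)%Z ->
  (forall L, lsum (box L) (fun k => (1 + sq k) * x k ^ 2) <= Cst) ->
  (forall k, In k (box N) -> z k = 0) -> (forall k, ~ In k (box N) -> z k = x k) ->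
  (forall k, In k (box N) -> Rabs (co k) <= 2 * INR N) ->
  lsum (box N) (fun k => Rabs (co k * (x k * z (fst k + c, snd k + d)%Z))) <= 8 * Cst / INR N.
Proof.
  intros HN Hm Hc Hd HC Hz1 Hz2 Hco.
  set (W := fun k : mode => (1 + sq k) * x k ^ 2).
  assert (HN' : 0 < INR N) by (apply lt_0_INR; lia).
  apply Rle_trans with
    (lsum (box N) (fun k => 4 / INR N * (W k + W (fst k + c, snd k + d)%Z))).
  - apply lsum_le; intros k Hk; set (k' := (fst k + c, snd k + d)%Z).
    assert (Hsk := sq_nonneg k); assert (Hsk' := sq_nonneg k').
    destruct (in_dec mode_eq_dec k' (box N)) as [Hin|Hout].
    + rewrite (Hz1 _ Hin), !Rmult_0_r, Rabs_R0.
      apply Rmult_le_pos; [apply Rlt_le, Rdiv_lt_0_compat; lra|].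
      unfold W; apply Rplus_le_le_0_compat; apply Rmult_le_pos; nra.
    + rewrite (Hz2 _ Hout).
      assert (H1 : INR N ^ 2 / 4 <= sq k).
      { destruct (Nat.Even_or_Odd N) as [[n Hn]|[n Hn]].
        - assert (Ho : ~ In k (box n)).
          { intros Hb; apply Hout; rewrite in_box in Hb |- *; unfold k'; cbn [fst snd]; lia. }
          apply sq_out_box in Ho; rewrite Hn, mult_INR; cbn [INR]; lra.
        - assert (Ho : ~ In k (box n)).
          { intros Hb; apply Hout; rewrite in_box in Hb |- *; unfold k'; cbn [fst snd]; lia. }
          assert (Ho' : (Z.of_nat (S n) <= Z.abs (fst k) \/ Z.of_nat (S n) <= Z.abs (snd k))%Z).
          { clear - Ho; rewrite in_box in Ho; lia. }
          assert (HS : INR N <= 2 * INR (S n)).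
          { replace 2 with (INR 2) by reflexivity; rewrite <- mult_INR; apply le_INR; lia. }
          assert (Hs : forall a b : R, INR (S n) <= a -> INR N ^ 2 / 4 <= a ^ 2 + b ^ 2).
          { intros a b Ha; assert (Hb := pow2_ge_0 b).
            assert (INR N * INR N <= (2 * a) * (2 * a)) by (apply Rmult_le_compat; lra).
            lra. }
          unfold sq; rewrite <- (pow2_abs (IZR (fst k))), <- (pow2_abs (IZR (snd k))).
          rewrite <- !abs_IZR.
          destruct Ho' as [E|E]; apply IZR_le in E; rewrite <- INR_IZR_INZ in E;
            [|rewrite Rplus_comm]; now apply Hs. }
      assert (H2 : INR N ^ 2 / 4 <= sq k')
        by (apply sq_out_box in Hout; nra).
      assert (H3 : forall j : mode, INR N ^ 2 / 4 <= sq j -> x j ^ 2 <= 4 / INR N ^ 2 * W j).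
      { intros j Hj; unfold W.
        assert (0 <= x j ^ 2) by apply pow2_ge_0.
        replace (4 / INR N ^ 2 * ((1 + sq j) * x j ^ 2))
          with (x j ^ 2 * ((1 + sq j) / (INR N ^ 2 / 4))) by (field; lra).
        rewrite <- (Rmult_1_r (x j ^ 2)) at 1; apply Rmult_le_compat_l; [assumption|].
        apply Rle_div_r; [apply Rdiv_lt_0_compat; nra|lra]. }
      apply H3 in H1; apply H3 in H2.
      rewrite Rabs_mult.
      apply Rle_trans with (2 * INR N * ((x k ^ 2 + x k' ^ 2) / 2)).
      * apply Rmult_le_compat; try apply Rabs_pos; [now apply Hco|].
        apply Rabs_le; split; [assert (H := pow2_ge_0 (x k + x k'))
                              |assert (H := pow2_ge_0 (x k - x k'))]; lra.
      * apply Rle_trans with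
          (INR N * (4 / INR N ^ 2 * W k + 4 / INR N ^ 2 * W k')); [nra|].
        apply Req_le; field; lra.
  - rewrite lsum_scal, lsum_plus.
    assert (H1 := HC N).
    assert (H2 : lsum (box N) (fun k => W (fst k + c, snd k + d)%Z) <= Cst).
    { apply Rle_trans with (2 := HC (N + m)%nat).
      apply (lsum_inj_le (fun k : mode => (fst k + c, snd k + d)%Z) (box N) (box (N + m)) W).
      - apply NoDup_box.
      - intros [a b] [a' b'] E; cbn in E; inversion E; f_equal; lia.
      - intros k; rewrite !in_box; cbn [fst snd]; lia.
      - intros k; unfold W; assert (H := sq_nonneg k); apply Rmult_le_pos; nra. }
    apply Rle_trans with (4 / INR N * (Cst + Cst)); [|apply Req_le; field; lra].
    apply Rmult_le_compat_l; [apply Rlt_le, Rdiv_lt_0_compat; lra|].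
    unfold W in *; lra.
Qed.

(* Cutting [x] off outside the box leaves, by skew-symmetry, only the
   interactions across the boundary of the box, and these are paid by one derivative. *)
Lemma flux_bound (N m : nat) (x : mode -> R) (Cst : R) :
  (0 < N)%nat -> (2 * m <= N)%nat ->
  (forall L, lsum (box L) (fun k => (1 + sq k) * x k ^ 2) <= Cst) ->
  Rabs (lsum (box N) (fun k => x k * adv (Z.of_nat m) x k)) <= 32 * Cst / INR N.
Proof.
  intros HN Hm HC.
  set (dec := in_dec mode_eq_dec).
  set (y := fun k : mode => if dec k (box N) then x k else 0).
  set (z := fun k : mode => if dec k (box N) then 0 else x k).
  set (M := Z.of_nat m).
  assert (Hz1 : forall k, In k (box N) -> z k = 0)
    by (intros k Hk; unfold z; now destruct (dec k (box N))).
  assert (Hz2 : forall k, ~ In k (box N) -> z k = x k)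
    by (intros k Hk; unfold z; now destruct (dec k (box N))).
  assert (Hxy : forall k, x k = y k + z k)
    by (intros k; unfold y, z; destruct (dec k (box N)); ring).
  assert (E : lsum (box N) (fun k => x k * adv M x k) = lsum (box N) (fun k => x k * adv M z k)).
  { rewrite <- (Rplus_0_l (lsum (box N) (fun k => x k * adv M z k))).
    rewrite <- (adv_skew N M y), <- lsum_plus.
    - apply lsum_ext; intros k Hk; unfold adv.
      rewrite !(Hxy (_, _)).
      replace (y k) with (x k) by (unfold y; destruct (dec k (box N)); tauto).
      ring.
    - intros k; unfold y; destruct (dec k (box N)); tauto. }
  rewrite E.
  apply Rle_trans with (1 := lsum_abs _ _).
  assert (HN' : 0 < INR N) by (apply lt_0_INR; lia).
  assert (F : forall c d (co : mode -> R), (Z.abs c <= M)%Z -> (Z.abs d <= M)%Z ->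
    (forall k, In k (box N) -> Rabs (co k) <= 2 * INR N) ->
    lsum (box N) (fun k => Rabs (co k * (x k * z (fst k + c, snd k + d)%Z))) <= 8 * Cst / INR N).
  { intros c d co Hc Hd Hco; now apply (flux_term N m c d x z co Cst). }
  assert (Hp : forall k, In k (box N) -> Rabs (IZR (fst k) + IZR (snd k)) <= 2 * INR N).
  { intros k Hk; apply in_box in Hk as [H1 H2]; apply IZR_bound in H1, H2.
    apply Rabs_le; lra. }
  assert (Hmn : forall k, In k (box N) -> Rabs (IZR (fst k) - IZR (snd k)) <= 2 * INR N).
  { intros k Hk; apply in_box in Hk as [H1 H2]; apply IZR_bound in H1, H2.
    apply Rabs_le; lra. }
  assert (F1 := F (- M)%Z (- M)%Z _ ltac:(lia) ltac:(lia) Hmn).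
  assert (F2 := F (- M)%Z M _ ltac:(lia) ltac:(lia) Hp).
  assert (F3 := F M (- M)%Z _ ltac:(lia) ltac:(lia) Hp).
  assert (F4 := F M M _ ltac:(lia) ltac:(lia) Hmn).
  replace (32 * Cst / INR N) with
    (8 * Cst / INR N + 8 * Cst / INR N + 8 * Cst / INR N + 8 * Cst / INR N) by (field; lra).
  apply Rle_trans with (2 := Rplus_le_compat _ _ _ _ (Rplus_le_compat _ _ _ _
    (Rplus_le_compat _ _ _ _ F1 F2) F3) F4).
  rewrite <- !lsum_plus; apply lsum_le; intros k _; unfold adv, Z.sub.
  set (p := IZR (fst k) - IZR (snd k)); set (q := IZR (fst k) + IZR (snd k)).
  match goal with |- Rabs (?u * (?a + ?b - ?c - ?d)) <= _ =>
    replace (u * (a + b - c - d)) with (u * a + u * b + - (u * c) + - (u * d)) by ring end.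
  repeat (apply Rle_trans with (1 := Rabs_triang _ _); apply Rplus_le_compat);
    rewrite ?Rabs_Ropp; apply Req_le; f_equal; ring.
Qed.

(** * The averaged relations along the separatrix *)

Definition prog (c m : R) (i : Z) : R := c + m * IZR i.

Lemma prog_succ (c m : R) (i : Z) : prog c m (i + 1) = prog c m i + m.
Proof. unfold prog; rewrite plus_IZR; ring. Qed.

Lemma prog_ge (c m : R) (n : nat) : 0 <= m -> c <= prog c m (Z.of_nat n).
Proof.
  intros Hm; unfold prog; rewrite <- INR_IZR_INZ; assert (H := pos_INR n); nra.
Qed.

(* If [e i = |S i|^2] and [h i = S (i-1) S (i+1)] are averages along an exact
   solution of [S i = p i * T i], [T i' = S (i-1) - S (i+1)], then [w = 0].  With
   [K i = p i (e (i+1) - h i)] the relation gives [K i + K (i-1) >= 0], while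
   [e i + h i] increases by [K i (1 / p i - 1 / p (i+1))]; the alternating sum of
   these increments is nonnegative because the second factor decreases. *)
Lemma relation_growth (c m w : R) (e h : Z -> R) (R0 : nat) :
  1 <= c -> 0 < m -> 0 <= w ->
  (forall i, - (e (i - 1)%Z + e (i + 1)%Z) / 2 <= h i <= (e (i - 1)%Z + e (i + 1)%Z) / 2) ->
  (forall i, (-1 <= i <= Z.of_nat R0)%Z ->
     Rabs (prog c m i * (e (i + 1)%Z - h i) - prog c m (i + 1) * (e i - h (i + 1)%Z)) <= w) ->
  e (-1)%Z - h 0%Z <= w ->
  forall N : nat, (N <= R0)%nat ->
    e (-1)%Z + e 0%Z <= e (Z.of_nat N) + h (Z.of_nat N) + (2 * INR N + 1 + c) * w.
Proof.
  intros Hc Hm Hw Hh Hrel H0.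
  set (p := fun n : nat => prog c m (Z.of_nat n)).
  set (K := fun n : nat => p n * (e (Z.of_nat n + 1)%Z - h (Z.of_nat n))).
  set (a := fun n : nat => / p n - / p (S n)).
  set (Sg := fix Sg (n : nat) : R := match n with O => 0 | S n' => Sg n' + a n' * K n' end).
  assert (Hp1 : forall n, 1 <= p n).
  { intros n; apply Rle_trans with (1 := Hc); apply prog_ge; lra. }
  assert (HpS : forall n, p (S n) = p n + m).
  { intros n; unfold p; rewrite Nat2Z.inj_succ; unfold Z.succ; apply prog_succ. }
  assert (Ha : forall n, 0 <= a n <= 1).
  { intros n; unfold a; assert (H1 := Hp1 n); assert (H2 := HpS n).
    assert (/ p (S n) <= / p n) by (apply Rinv_le_contravar; lra).
    assert (0 < / p (S n)) by (apply Rinv_0_lt_compat; lra).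
    assert (/ p n <= 1) by (rewrite <- Rinv_1; apply Rinv_le_contravar; lra).
    lra. }
  assert (Hdec : forall n, a (S n) <= a n).
  { intros n; unfold a; rewrite !HpS; assert (H1 := Hp1 n).
    assert (E : / p n - / (p n + m) - (/ (p n + m) - / (p n + m + m)) =
      2 * m ^ 2 / (p n * (p n + m) * (p n + m + m))) by (field; lra).
    assert (0 < 2 * m ^ 2 / (p n * (p n + m) * (p n + m + m))).
    { apply Rdiv_lt_0_compat; [nra|]; repeat apply Rmult_lt_0_compat; lra. }
    lra. }
  assert (HK0 : - c * w <= K 0%nat).
  { unfold K, p; cbn [Z.of_nat]; assert (H := Hh 0%Z); cbn [Z.sub Z.add Z.opp] in *.
    unfold prog; rewrite Rmult_0_r, Rplus_0_r.
    enough (- w <= e 1%Z - h 0%Z) by nra.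
    lra. }
  assert (HK : forall n, (n < R0)%nat -> - w - K n <= K (S n)).
  { intros n Hn.
    assert (Hr := Hrel (Z.of_nat n) ltac:(lia)); apply Rabs_le_between in Hr.
    unfold K; assert (H1 := Hp1 (S n)).
    assert (Hs := Hh (Z.of_nat (S n))).
    unfold p in *; rewrite Nat2Z.inj_succ in *; unfold Z.succ in *.
    replace (Z.of_nat n + 1 - 1)%Z with (Z.of_nat n) in Hs by lia.
    nra. }
  assert (HSg : forall n, (n <= R0)%nat -> - (INR n + c) * w <= Sg n /\
     forall b, 0 <= b <= 1 -> (forall n', S n' = n -> b <= a n') ->
       - (INR n + c) * w <= Sg n + b * K n).
  { induction n as [|n IH]; intros Hn.
    - cbn [Sg INR]; split; [nra|]; intros b Hb _.
      assert (0 <= c * w) by nra; nra.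
    - destruct IH as [IH1 IH2]; [lia|].
      assert (Hb1 : - (INR n + c) * w <= Sg (S n)).
      { cbn [Sg]; apply IH2; auto.
        intros n' <-; apply Hdec. }
      split; [rewrite S_INR; lra|].
      intros b Hb Hba; specialize (Hba n eq_refl).
      assert (HKn := HK n ltac:(lia)).
      assert (H1 : - (INR n + c) * w <= Sg n + (a n - b) * K n).
      { apply IH2; [assert (H := Ha n); lra|].
        intros n' <-; assert (H := Hdec n'); lra. }
      cbn [Sg]; rewrite S_INR; nra. }
  assert (HV : forall N, (N <= R0)%nat ->
    e (-1)%Z + e 0%Z - w + Sg N - INR N * w <= e (Z.of_nat N) + h (Z.of_nat N)).
  { induction N as [|N IH]; intros HN.
    - cbn [Sg INR Z.of_nat]; lra.
    - specialize (IH ltac:(lia)).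
      assert (Hr := Hrel (Z.of_nat N) ltac:(lia)); apply Rabs_le_between in Hr.
      cbn [Sg]; rewrite S_INR, Nat2Z.inj_succ; unfold Z.succ, a.
      assert (H1 := Hp1 N); assert (H2 := HpS N).
      assert (E : p (S N) = prog c m (Z.of_nat N + 1))
        by (unfold p; now rewrite Nat2Z.inj_succ).
      rewrite <- E in Hr; change (prog c m (Z.of_nat N)) with (p N) in Hr.
      set (z := e (Z.of_nat N) - h (Z.of_nat N + 1)%Z) in *.
      set (y := e (Z.of_nat N + 1)%Z - h (Z.of_nat N)) in *.
      change (K N) with (p N * y).
      assert (F1 : (/ p N - / p (S N)) * (p N * y) = y - p N * y / p (S N)) by (field; lra).
      assert (F2 : z <= p N * y / p (S N) + w).
      { apply Rle_trans with ((p N * y + w) / p (S N)).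
        - apply Rle_div_r; lra.
        - unfold Rdiv; rewrite Rmult_plus_distr_r; apply Rplus_le_compat_l.
          assert (/ p (S N) <= 1) by (rewrite <- Rinv_1; apply Rinv_le_contravar; lra).
          nra. }
      rewrite F1; unfold z, y in *; lra. }
  intros N HN; specialize (HV N HN); destruct (HSg N HN) as [HS _]; nra.
Qed.

Definition harm (n : nat) : R := lsum (seq 0 n) (fun i => / INR (i + 3)).

Lemma harm_ge (n : nat) : ln (INR (n + 3)) - ln 3 <= harm n.
Proof.
  induction n as [|n IH].
  - unfold harm; cbn [seq]; rewrite lsum_nil; cbn [Nat.add]; cbn [INR].
    replace (1 + 1 + 1) with 3 by ring; lra.
  - unfold harm in *; rewrite seq_S, lsum_app; cbn [Nat.add].
    rewrite lsum_cons, lsum_nil, S_INR, Rplus_0_r.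
    assert (Hn : 0 < INR (n + 3)) by (apply lt_0_INR; lia).
    enough (ln (INR (n + 3) + 1) <= ln (INR (n + 3)) + / INR (n + 3)) by lra.
    rewrite <- (ln_exp (/ INR (n + 3))), <- ln_mult by (assumption || apply exp_pos).
    apply ln_le; [lra|].
    apply Rle_trans with (INR (n + 3) * (1 + / INR (n + 3))).
    + apply Req_le; field; lra.
    + apply Rmult_le_compat_l; [lra|]; apply exp_ineq1_le.
Qed.

Lemma harm_unbounded (M : R) : exists n, M <= harm n.
Proof.
  destruct (INR_unbounded (exp (M + ln 3))) as [n Hn].
  exists n; apply Rle_trans with (2 := harm_ge n).
  assert (E : M + ln 3 <= ln (INR (n + 3))).
  { rewrite <- (ln_exp (M + ln 3)); apply ln_le; [apply exp_pos|].
    rewrite plus_INR; assert (0 <= INR 3) by apply pos_INR; lra. }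
  lra.
Qed.

Lemma relation_bound_half (c m w Q : R) (X h : Z -> R) (R0 : nat) :
  let e := fun i => Rabs (prog c m i) * X i in
  1 <= c <= m -> 0 <= w -> (forall i, 0 <= X i) ->
  (forall i, - (e (i - 1)%Z + e (i + 1)%Z) / 2 <= h i <= (e (i - 1)%Z + e (i + 1)%Z) / 2) ->
  (forall i, (-1 <= i <= Z.of_nat R0)%Z ->
     Rabs (prog c m i * (e (i + 1)%Z - h i) - prog c m (i + 1) * (e i - h (i + 1)%Z)) <= w) ->
  e (-1)%Z - h 0%Z <= w ->
  lsum (seq 0 (R0 + 2)) (fun n => X (Z.of_nat n)) <= Q ->
  (e (-1)%Z + e 0%Z) * harm R0 <= m * (3 * Q + INR R0 * ((2 * INR R0 + 1 + m) * w)).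
Proof.
  intros e Hc Hw HX Hh Hrel H0 HQ.
  assert (He : forall i, 0 <= e i) by (intros i; apply Rmult_le_pos; [apply Rabs_pos|apply HX]).
  assert (Hee : forall n : nat, e (Z.of_nat n) = prog c m (Z.of_nat n) * X (Z.of_nat n)).
  { intros n; unfold e; rewrite Rabs_pos_eq; [reflexivity|].
    assert (H := prog_ge c m n ltac:(lra)); lra. }
  assert (Hmono : forall n : nat, prog c m (Z.of_nat (S n)) = prog c m (Z.of_nat n) + m).
  { intros n; rewrite Nat2Z.inj_succ; apply prog_succ. }
  set (F := e (-1)%Z + e 0%Z).
  assert (HF : 0 <= F) by (unfold F; assert (H1 := He (-1)%Z); assert (H2 := He 0%Z); lra).
  set (C := (2 * INR R0 + 1 + m) * w).
  assert (HC : 0 <= C) by (unfold C; assert (H := pos_INR R0); apply Rmult_le_pos; lra).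
  assert (Hterm : forall n, In n (seq 0 R0) -> F * / INR (n + 3) <=
    m * (X (Z.of_nat n) + X (Z.of_nat (S n)) + X (Z.of_nat (S (S n))) + C)).
  { intros n Hn; apply in_seq in Hn.
    assert (HG := relation_growth c m w e h R0 ltac:(lra) ltac:(lra) Hw Hh Hrel H0 (S n) ltac:(lia)).
    assert (Hh' := Hh (Z.of_nat (S n))).
    replace (Z.of_nat (S n) - 1)%Z with (Z.of_nat n) in Hh' by lia.
    replace (Z.of_nat (S n) + 1)%Z with (Z.of_nat (S (S n))) in Hh' by lia.
    rewrite !Hee in *.
    assert (Hp0 := prog_ge c m n ltac:(lra)).
    assert (Hp1 := Hmono n); assert (Hp2 := Hmono (S n)).
    set (p2 := prog c m (Z.of_nat (S (S n)))) in *.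
    assert (X0 := HX (Z.of_nat n)); assert (X1 := HX (Z.of_nat (S n)));
      assert (X2 := HX (Z.of_nat (S (S n)))).
    assert (HS : INR (S n) <= INR R0) by (apply le_INR; lia).
    assert (HCw : (2 * INR (S n) + 1 + c) * w <= C)
      by (unfold C; apply Rmult_le_compat_r; lra).
    assert (Hfin : F <= p2 * (X (Z.of_nat n) + X (Z.of_nat (S n)) + X (Z.of_nat (S (S n))) + C)).
    { unfold F in *; nra. }
    assert (Hp2m : p2 <= m * INR (n + 3)).
    { unfold p2, prog; rewrite <- INR_IZR_INZ, !S_INR, plus_INR; cbn [INR].
      assert (H := pos_INR n); nra. }
    assert (Hn3 : 0 < INR (n + 3)) by (apply lt_0_INR; lia).
    apply Rle_div_l; [assumption|].
    apply Rle_trans with (1 := Hfin).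
    set (Y := X (Z.of_nat n) + X (Z.of_nat (S n)) + X (Z.of_nat (S (S n))) + C) in *.
    assert (0 <= Y) by (unfold Y; lra).
    apply Rle_trans with (m * INR (n + 3) * Y); [now apply Rmult_le_compat_r|].
    apply Req_le; ring. }
  unfold harm; rewrite <- lsum_scal.
  apply Rle_trans with (1 := lsum_le _ _ _ Hterm).
  rewrite lsum_scal; apply Rmult_le_compat_l; [lra|].
  rewrite !lsum_plus, lsum_const, length_seq.
  assert (Hinj : forall d, (d <= 2)%nat ->
    lsum (seq 0 R0) (fun n => X (Z.of_nat (d + n))) <= Q).
  { intros d Hd; apply Rle_trans with (2 := HQ).
    apply (lsum_inj_le (fun n => d + n)%nat (seq 0 R0) (seq 0 (R0 + 2))
             (fun n => X (Z.of_nat n))).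
    - apply seq_NoDup.
    - intros a b; lia.
    - intros a; rewrite !in_seq; lia.
    - intros b; apply HX. }
  assert (I0 := Hinj 0%nat ltac:(lia)); assert (I1 := Hinj 1%nat ltac:(lia));
    assert (I2 := Hinj 2%nat ltac:(lia)); cbn [Nat.add] in I0, I1, I2.
  lra.
Qed.

Lemma relation_bound (c m w Q : R) (X h : Z -> R) (R0 : nat) :
  let e := fun i => Rabs (prog c m i) * X i in
  1 <= c <= m - 1 -> 0 <= w -> (forall i, 0 <= X i) ->
  (forall i, - (e (i - 1)%Z + e (i + 1)%Z) / 2 <= h i <= (e (i - 1)%Z + e (i + 1)%Z) / 2) ->
  (forall i, (Z.abs i <= Z.of_nat R0 + 2)%Z ->
     Rabs (prog c m i * (e (i + 1)%Z - h i) - prog c m (i + 1) * (e i - h (i + 1)%Z)) <= w) ->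
  lsum (zrange (R0 + 2)) X <= Q ->
  (e (-1)%Z + e 0%Z) * harm R0 <= m * (3 * Q + INR R0 * ((2 * INR R0 + 1 + m) * w)).
Proof.
  intros e Hc Hw HX Hh Hrel HQ.
  destruct (Rle_lt_dec (e (-1)%Z - h 0%Z) w) as [Hz|Hz].
  - apply (relation_bound_half c m w Q X h R0); auto; try lra.
    + intros i Hi; apply Hrel; lia.
    + apply Rle_trans with (2 := HQ).
      apply (lsum_inj_le Z.of_nat); auto using seq_NoDup.
      * intros a b; lia.
      * intros a; rewrite in_seq, in_zrange; lia.
  - (* the sign is right after the reflection [i -> -1 - i] *)
    set (r := fun i : Z => (-1 - i)%Z).
    assert (Hpr : forall i, prog (m - c) m i = - prog c m (r i)).
    { intros i; unfold prog, r; rewrite minus_IZR; ring. }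
    set (X' := fun i => X (r i)); set (h' := fun i => h (r i)).
    assert (Hee : forall i, Rabs (prog (m - c) m i) * X' i = e (r i)).
    { intros i; unfold e, X'; now rewrite Hpr, Rabs_Ropp. }
    assert (HB := relation_bound_half (m - c) m w Q X' h' R0).
    cbv zeta beta in HB; rewrite !Hee in HB.
    unfold r in HB; cbn [Z.sub Z.add Z.opp Z.pos_sub] in HB.
    change (-1 - -1)%Z with 0%Z in HB; change (-1 - 0)%Z with (-1)%Z in HB.
    rewrite (Rplus_comm (e (-1)%Z)).
    apply HB; auto; try lra.
    + intros i; apply HX.
    + intros i; rewrite !Hee; unfold h', r.
      specialize (Hh (-1 - i)%Z).
      replace (-1 - (i - 1))%Z with (-1 - i + 1)%Z by lia.
      replace (-1 - (i + 1))%Z with (-1 - i - 1)%Z by lia.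
      lra.
    + intros i Hi; rewrite !Hee, !Hpr; unfold h', r.
      specialize (Hrel (-2 - i)%Z ltac:(lia)).
      replace (-1 - (i + 1))%Z with (-2 - i)%Z by lia.
      replace (-2 - i + 1)%Z with (-1 - i)%Z in Hrel by lia.
      match goal with |- Rabs ?u <= _ => match type of Hrel with Rabs ?v <= _ =>
        replace u with v by ring end end.
      exact Hrel.
    + unfold h'; unfold r; change (-1 - 0)%Z with (-1)%Z.
      specialize (Hrel (-1)%Z ltac:(lia)); cbn [Z.add Z.pos_sub] in Hrel.
      apply Rabs_le_between in Hrel.
      unfold prog in Hrel.
      assert (E1 : c + m * -1 <= -1) by lra.
      assert (E0 : 1 <= c + m * 0) by lra.
      set (z := e (-1)%Z - h 0%Z) in *; set (y := e 0%Z - h (-1)%Z) in *.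
      change (e (-1 + 1)%Z) with (e 0%Z) in Hrel; change (h (-1 + 1)%Z) with (h 0%Z) in Hrel.
      fold z y in Hrel.
      destruct (Rle_lt_dec y w) as [|Hy]; [assumption|exfalso].
      change (IZR (-1 + 1)) with 0 in Hrel.
      nra.
    + apply Rle_trans with (2 := HQ).
      apply (lsum_inj_le (fun n => r (Z.of_nat n)) _ _ X); auto using seq_NoDup.
      * intros a b; unfold r; lia.
      * intros a; unfold r; rewrite in_seq, in_zrange; lia.
Qed.

(** * Integrals of continuous functions *)

Definition cont_on (a b : R) (f : R -> R) : Prop :=
  forall t, a <= t <= b -> continuous f t.

Lemma cont_const (a b c : R) : cont_on a b (fun _ => c).
Proof. intros t _; apply continuous_const. Qed.

Lemma cont_plus (a b : R) (f g : R -> R) :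
  cont_on a b f -> cont_on a b g -> cont_on a b (fun t => f t + g t).
Proof. intros Hf Hg t Ht; apply (continuous_plus f g t); auto. Qed.

Lemma cont_mult (a b : R) (f g : R -> R) :
  cont_on a b f -> cont_on a b g -> cont_on a b (fun t => f t * g t).
Proof. intros Hf Hg t Ht; apply (continuous_mult f g t); auto. Qed.

Lemma cont_minus (a b : R) (f g : R -> R) :
  cont_on a b f -> cont_on a b g -> cont_on a b (fun t => f t - g t).
Proof. intros Hf Hg t Ht; apply (continuous_minus f g t); auto. Qed.

Lemma cont_pow (a b : R) (f : R -> R) (n : nat) :
  cont_on a b f -> cont_on a b (fun t => f t ^ n).
Proof.
  intros Hf; induction n as [|n IH]; cbn [pow]; [apply cont_const|now apply cont_mult].
Qed.

Lemma cont_lsum {T : Type} (a b : R) (l : list T) (f : R -> T -> R) :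
  (forall k, cont_on a b (fun t => f t k)) -> cont_on a b (fun t => lsum l (f t)).
Proof.
  intros Hf; induction l as [|k l IH]; [exact (cont_const a b 0)|].
  now apply (cont_plus a b (fun t => f t k) (fun t => lsum l (f t))).
Qed.

Ltac cont_tac :=
  repeat match goal with
  | |- cont_on _ _ (fun _ => ?c) => apply (cont_const _ _ c)
  | |- cont_on _ _ (fun _ => _ + _) => apply cont_plus
  | |- cont_on _ _ (fun _ => _ - _) => apply cont_minus
  | |- cont_on _ _ (fun _ => _ * _) => apply cont_mult
  | |- cont_on _ _ (fun _ => _ ^ _) => apply cont_pow
  | |- cont_on _ _ (fun _ => lsum _ _) => apply cont_lsum; intros
  end; try assumption.

Lemma cont_ex_RInt (a b : R) (f : R -> R) : a <= b -> cont_on a b f -> ex_RInt f a b.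
Proof.
  intros Hab Hf; apply (@ex_RInt_continuous R_CompleteNormedModule).
  intros t; rewrite Rmin_left, Rmax_right by assumption; apply Hf.
Qed.

Definition integral (f : R -> R) (a b : R) : R := RInt f a b.

Lemma int_plus (a b : R) (f g : R -> R) :
  a <= b -> cont_on a b f -> cont_on a b g ->
  integral (fun t => f t + g t) a b = integral f a b + integral g a b.
Proof.
  intros Hab Hf Hg.
  apply (@RInt_plus R_CompleteNormedModule f g); now apply cont_ex_RInt.
Qed.

Lemma int_minus (a b : R) (f g : R -> R) :
  a <= b -> cont_on a b f -> cont_on a b g ->
  integral (fun t => f t - g t) a b = integral f a b - integral g a b.
Proof.
  intros Hab Hf Hg.
  apply (@RInt_minus R_CompleteNormedModule f g); now apply cont_ex_RInt.
Qed.

Lemma int_scal (a b c : R) (f : R -> R) :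
  a <= b -> cont_on a b f -> integral (fun t => c * f t) a b = c * integral f a b.
Proof.
  intros Hab Hf; apply (@RInt_scal R_CompleteNormedModule f); now apply cont_ex_RInt.
Qed.

Lemma int_const (a b c : R) : integral (fun _ => c) a b = (b - a) * c.
Proof. apply (@RInt_const R_CompleteNormedModule). Qed.

Lemma int_le (a b : R) (f g : R -> R) :
  a <= b -> cont_on a b f -> cont_on a b g -> (forall t, a <= t <= b -> f t <= g t) ->
  integral f a b <= integral g a b.
Proof.
  intros Hab Hf Hg H; apply RInt_le; auto; try now apply cont_ex_RInt.
  intros t Ht; apply H; lra.
Qed.

Lemma int_ext (a b : R) (f g : R -> R) :
  (forall t, f t = g t) -> integral f a b = integral g a b.
Proof. intros H; apply RInt_ext; intros t _; apply H. Qed.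

Lemma int_nonneg (a b : R) (f : R -> R) :
  a <= b -> cont_on a b f -> (forall t, a <= t <= b -> 0 <= f t) -> 0 <= integral f a b.
Proof.
  intros Hab Hf H; rewrite <- (Rmult_0_r (b - a)), <- int_const.
  apply int_le; auto using cont_const.
Qed.

Lemma int_lsum {T : Type} (a b : R) (l : list T) (f : R -> T -> R) :
  a <= b -> (forall k, cont_on a b (fun t => f t k)) ->
  integral (fun t => lsum l (f t)) a b = lsum l (fun k => integral (fun t => f t k) a b).
Proof.
  intros Hab Hf; induction l as [|k l IH].
  - rewrite lsum_nil; rewrite (int_ext a b _ (fun _ => 0)) by reflexivity.
    rewrite int_const; ring.
  - rewrite lsum_cons, <- IH.
    apply (int_plus a b (fun t => f t k) (fun t => lsum l (f t))); auto.
    now apply cont_lsum.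
Qed.

Lemma int_derive (a b : R) (f df : R -> R) :
  a <= b -> (forall t, a <= t <= b -> is_derive f t (df t)) -> cont_on a b df ->
  integral df a b = f b - f a.
Proof.
  intros Hab Hf Hdf; apply is_RInt_unique.
  apply (@is_RInt_derive R_CompleteNormedModule f df); intros t;
    rewrite Rmin_left, Rmax_right by assumption; auto.
Qed.

Lemma int_bound_up_to_derivative (a b lam al be : R) (f u du G : R -> R) :
  a <= b -> cont_on a b f -> cont_on a b du -> cont_on a b G ->
  (forall t, a <= t <= b -> is_derive u t (du t)) ->
  (forall t, a <= t <= b -> Rabs (f t + lam * du t) <= al * G t + be) ->
  Rabs (integral f a b) <= Rabs lam * Rabs (u b - u a) + al * integral G a b + (b - a) * be.
Proof.
  intros Hab Hf Hdu HG Hu Hb.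
  assert (E : integral (fun t => f t + lam * du t) a b = integral f a b + lam * (u b - u a)).
  { rewrite int_plus, int_scal, (int_derive a b u du) by (cont_tac; auto); reflexivity. }
  assert (E' : integral (fun t => al * G t + be) a b = al * integral G a b + (b - a) * be).
  { rewrite int_plus, int_scal, int_const by (cont_tac; auto); reflexivity. }
  assert (H1 : Rabs (integral f a b + lam * (u b - u a)) <= al * integral G a b + (b - a) * be).
  { rewrite <- E, <- E'.
    apply Rabs_le; split.
    - rewrite <- (Ropp_involutive (integral (fun t => f t + lam * du t) a b)).
      apply Ropp_le_contravar.
      replace (- integral (fun t => f t + lam * du t) a b)
        with (integral (fun t => -1 * (f t + lam * du t)) a b)
        by (rewrite int_scal by (auto; cont_tac); ring).
      apply int_le; auto; try cont_tac.
      intros t Ht; specialize (Hb t Ht); apply Rabs_le_between in Hb; lra.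
    - apply int_le; auto; try cont_tac.
      intros t Ht; specialize (Hb t Ht); apply Rabs_le_between in Hb; lra. }
  rewrite <- Rabs_mult.
  replace (integral f a b) with
    (integral f a b + lam * (u b - u a) + - (lam * (u b - u a))) by ring.
  apply Rle_trans with (1 := Rabs_triang _ _); rewrite Rabs_Ropp; lra.
Qed.

Lemma is_derive_lsum {T : Type} (l : list T) (f : R -> T -> R) (df : T -> R) (t : R) :
  (forall k, is_derive (fun s => f s k) t (df k)) ->
  is_derive (fun s => lsum l (f s)) t (lsum l df).
Proof.
  intros H; induction l as [|k l IH].
  - apply (is_derive_const (V := R_NormedModule) 0).
  - apply (is_derive_plus (V := R_NormedModule) (fun s => f s k) (fun s => lsum l (f s)));
      auto.
Qed.

Lemma is_derive_prod (f g : R -> R) (t df dg : R) :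
  is_derive f t df -> is_derive g t dg ->
  is_derive (fun s => f s * g s) t (df * g t + f t * dg).
Proof.
  intros Hf Hg; apply (is_derive_mult f g t df dg Hf Hg); intros; apply Rmult_comm.
Qed.

Lemma is_derive_cmul (f : R -> R) (c t df : R) :
  is_derive f t df -> is_derive (fun s => c * f s) t (c * df).
Proof. intros Hf; now apply (is_derive_scal f t c df). Qed.

Lemma is_derive_cont_on (a b : R) (f df : R -> R) :
  (forall t, a <= t <= b -> is_derive f t (df t)) -> cont_on a b f.
Proof. intros H t Ht; apply (@ex_derive_continuous R_AbsRing R_NormedModule); eexists; eauto. Qed.

(** * Traces on the separatrix *)

Definition tent (J : nat) (j : Z) : R := Rmax 0 (1 - IZR (Z.abs j) / INR J).

Lemma tent_0 (J : nat) : tent J 0 = 1.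
Proof. unfold tent, Rdiv; cbn [Z.abs]; rewrite Rmult_0_l, Rmax_right; lra. Qed.

Lemma tent_bound (J : nat) (j : Z) : (0 < J)%nat -> 0 <= tent J j <= 1.
Proof.
  intros HJ; unfold tent; split; [apply Rmax_l|]; apply Rmax_lub; [lra|].
  assert (0 <= IZR (Z.abs j) / INR J)
    by (apply Rdiv_le_0_compat; [apply IZR_le; lia|apply lt_0_INR; lia]); lra.
Qed.

Lemma tent_supp (J : nat) (j : Z) : (0 < J)%nat -> tent J j <> 0 -> (Z.abs j < Z.of_nat J)%Z.
Proof.
  intros HJ H; apply Z.nle_gt; intros Hle; apply H; unfold tent; apply Rmax_left.
  apply IZR_le in Hle; rewrite <- INR_IZR_INZ in Hle.
  assert (HJ' : 0 < INR J) by (apply lt_0_INR; lia).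
  enough (1 <= IZR (Z.abs j) / INR J) by lra.
  apply Rle_div_r; lra.
Qed.

Lemma tent_lip (J : nat) (j : Z) : (0 < J)%nat -> Rabs (tent J (j + 1) - tent J j) <= / INR J.
Proof.
  intros HJ; assert (HJ' : 0 < / INR J) by (apply Rinv_0_lt_compat, lt_0_INR; lia).
  assert (H : -1 <= IZR (Z.abs (j + 1)) - IZR (Z.abs j) <= 1)
    by (rewrite <- minus_IZR; split; apply IZR_le; lia).
  unfold tent, Rdiv.
  assert (H1 : - / INR J <= IZR (Z.abs (j + 1)) * / INR J - IZR (Z.abs j) * / INR J <= / INR J)
    by (split; nra).
  apply Rabs_le; unfold Rmax; destruct (Rle_dec _ _), (Rle_dec _ _); lra.
Qed.

(* The trace on the line [x2 = 0], along the residue class [kap] modulo [m] of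
   the second frequency, smoothly cut off at distance [J]. *)
Definition trace (c kap m : Z) (J : nat) (y : mode -> R) (i : Z) : R :=
  lsum (zrange J) (fun j => tent J j * y (c + m * i, kap + m * j)%Z).

Definition column (c kap m : Z) (J : nat) (y : mode -> R) (i : Z) : R :=
  lsum (zrange J) (fun j => sq (c + m * i, kap + m * j)%Z * y (c + m * i, kap + m * j)%Z ^ 2).

Definition flow_trace (c kap m : Z) (J : nat) (y : mode -> R) (i : Z) : R :=
  IZR (c + m * i) * trace c kap m J y i.

Lemma tent_shift (J : nat) (d : Z) (f : Z -> R) :
  (0 < J)%nat -> (Z.abs d <= 1)%Z ->
  lsum (zrange J) (fun j => tent J j * f j) =
  lsum (zrange J) (fun j => tent J (j + d) * f (j + d)%Z).
Proof.
  intros HJ Hd; symmetry; apply (lsum_zrange_shift J d (fun j => tent J j * f j)).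
  intros i Hi; assert (H : tent J i <> 0) by (intros E; apply Hi; rewrite E; ring).
  apply tent_supp in H; auto; rewrite !in_zrange; lia.
Qed.

Lemma trace_adv_split (c kap m : Z) (J : nat) (y : mode -> R) (i : Z) :
  (0 < J)%nat ->
  let p := fun i => IZR (c + m * i) in
  let q := fun j => IZR (kap + m * j) in
  let z := fun i j => y (c + m * i, kap + m * j)%Z in
  lsum (zrange J) (fun j => tent J j * adv m y (c + m * i, kap + m * j)%Z)
  - (2 * flow_trace c kap m J y (i - 1) - 2 * flow_trace c kap m J y (i + 1)) =
  lsum (zrange J) (fun j =>
    (p (i - 1)%Z * (tent J (j + 1) + tent J (j - 1) - 2 * tent J j)
     - q j * (tent J (j + 1) - tent J (j - 1))) * z (i - 1)%Z j
    - (p (i + 1)%Z * (tent J (j + 1) + tent J (j - 1) - 2 * tent J j)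
     + q j * (tent J (j + 1) - tent J (j - 1))) * z (i + 1)%Z j).
Proof.
  intros HJ p q z.
  assert (Hp1 : p (i - 1)%Z = p i - IZR m)
    by (unfold p; rewrite <- minus_IZR; f_equal; lia).
  assert (Hp2 : p (i + 1)%Z = p i + IZR m)
    by (unfold p; rewrite <- plus_IZR; f_equal; lia).
  assert (Hq1 : forall j, q (j + -1)%Z = q j - IZR m)
    by (intros; unfold q; rewrite <- minus_IZR; f_equal; lia).
  assert (Hq2 : forall j, q (j + 1)%Z = q j + IZR m)
    by (intros; unfold q; rewrite <- plus_IZR; f_equal; lia).
  assert (E1 := tent_shift J 1 (fun j => (p i - q j) * z (i - 1)%Z (j - 1)%Z) HJ ltac:(lia)).
  assert (E2 := tent_shift J (-1) (fun j => (p i + q j) * z (i - 1)%Z (j + 1)%Z) HJ ltac:(lia)).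
  assert (E3 := tent_shift J 1 (fun j => (p i + q j) * z (i + 1)%Z (j - 1)%Z) HJ ltac:(lia)).
  assert (E4 := tent_shift J (-1) (fun j => (p i - q j) * z (i + 1)%Z (j + 1)%Z) HJ ltac:(lia)).
  cbv beta in E1, E2, E3, E4.
  rewrite (lsum_ext (zrange J) _ (fun j =>
      tent J j * ((p i - q j) * z (i - 1)%Z (j - 1)%Z)
      + tent J j * ((p i + q j) * z (i - 1)%Z (j + 1)%Z)
      - tent J j * ((p i + q j) * z (i + 1)%Z (j - 1)%Z)
      - tent J j * ((p i - q j) * z (i + 1)%Z (j + 1)%Z))).
  2:{ intros j _; unfold adv, z; cbn [fst snd]; fold (p i) (q j).
      replace (c + m * i - m)%Z with (c + m * (i - 1))%Z by lia.
      replace (c + m * i + m)%Z with (c + m * (i + 1))%Z by lia.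
      replace (kap + m * j - m)%Z with (kap + m * (j - 1))%Z by lia.
      replace (kap + m * j + m)%Z with (kap + m * (j + 1))%Z by lia.
      ring. }
  rewrite !lsum_minus, lsum_plus, E1, E2, E3, E4.
  unfold flow_trace, trace; fold (p (i - 1)%Z) (p (i + 1)%Z).
  rewrite <- !lsum_scal, <- !lsum_plus, <- !lsum_minus.
  apply lsum_ext; intros j _; fold (z (i - 1)%Z j) (z (i + 1)%Z j).
  rewrite !Hq1, !Hq2, !Hp1, !Hp2.
  replace (j + 1 - 1)%Z with j by lia; replace (j + -1 + 1)%Z with j by lia.
  replace (j + -1)%Z with (j - 1)%Z by lia.
  ring.
Qed.

Lemma trace_adv_error (c kap m : Z) (J : nat) (y : mode -> R) (i : Z) :
  (0 < J)%nat ->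
  (lsum (zrange J) (fun j => tent J j * adv m y (c + m * i, kap + m * j)%Z)
   - (2 * flow_trace c kap m J y (i - 1) - 2 * flow_trace c kap m J y (i + 1))) ^ 2
  <= 48 / INR J * (column c kap m J y (i - 1) + column c kap m J y (i + 1)).
Proof.
  intros HJ; rewrite trace_adv_split by assumption.
  set (p := fun i => IZR (c + m * i)); set (q := fun j => IZR (kap + m * j)).
  set (z := fun i j => y (c + m * i, kap + m * j)%Z).
  assert (HJ1 : 1 <= INR J) by (apply (le_INR 1); lia).
  assert (HJ' : 0 < / INR J) by (apply Rinv_0_lt_compat; lra).
  set (A := fun i => lsum (zrange J) (fun j => (Rabs (p i) + Rabs (q j)) * Rabs (z i j))).
  assert (HA0 : forall i, 0 <= A i).
  { intros i'; apply lsum_nonneg; intros j _; apply Rmult_le_pos; [|apply Rabs_pos].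
    apply Rplus_le_le_0_compat; apply Rabs_pos. }
  assert (HA : forall i, A i ^ 2 <= 6 * INR J * column c kap m J y i).
  { intros i'; unfold A; apply Rle_trans with (1 := lsum_sqr_le _ _).
    rewrite length_zrange, plus_INR, mult_INR; cbn [INR].
    apply Rle_trans with (3 * INR J * (2 * column c kap m J y i')); [|apply Req_le; ring].
    apply Rmult_le_compat; try lra.
    - apply lsum_nonneg; intros; apply pow2_ge_0.
    - unfold column; rewrite <- lsum_scal; apply lsum_le; intros j _.
      rewrite Rpow_mult_distr, pow2_abs; unfold sq; cbn [fst snd].
      fold (p i') (q j) (z i' j).
      rewrite <- (pow2_abs (p i')), <- (pow2_abs (q j)), <- Rmult_assoc.
      apply Rmult_le_compat_r; [apply pow2_ge_0|].
      assert (H := pow2_ge_0 (Rabs (p i') - Rabs (q j))); lra. }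
  match goal with |- ?u ^ 2 <= _ =>
    assert (HB : Rabs u <= 2 / INR J * (A (i - 1)%Z + A (i + 1)%Z)) end.
  { apply Rle_trans with (1 := lsum_abs _ _); unfold A.
    rewrite <- lsum_plus, <- lsum_scal; apply lsum_le; intros j _.
    fold (p (i - 1)%Z) (p (i + 1)%Z) (q j) (z (i - 1)%Z j) (z (i + 1)%Z j).
    assert (L1 := tent_lip J j HJ); assert (L2 := tent_lip J (j - 1) HJ).
    replace (j - 1 + 1)%Z with j in L2 by lia.
    set (t := / INR J) in *; unfold Rdiv; fold t.
    assert (D1 : Rabs (tent J (j + 1) + tent J (j - 1) - 2 * tent J j) <= 2 * t).
    { apply Rabs_le_between in L1, L2; apply Rabs_le; lra. }
    assert (D2 : Rabs (tent J (j + 1) - tent J (j - 1)) <= 2 * t).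
    { apply Rabs_le_between in L1, L2; apply Rabs_le; lra. }
    set (d1 := tent J (j + 1) + tent J (j - 1) - 2 * tent J j) in *.
    set (d2 := tent J (j + 1) - tent J (j - 1)) in *.
    assert (B : forall a b s : R, Rabs ((a * d1 + s * (b * d2))) <=
                 Rabs a * (2 * t) + Rabs s * (Rabs b * (2 * t))).
    { intros a b s; apply Rle_trans with (1 := Rabs_triang _ _).
      rewrite !Rabs_mult; apply Rplus_le_compat; repeat apply Rmult_le_compat_l;
        auto using Rabs_pos. }
    assert (B1 := B (p (i - 1)%Z) (q j) (-1)); assert (B2 := B (p (i + 1)%Z) (q j) 1).
    rewrite Rabs_R1 in B2; rewrite Rabs_m1 in B1.
    replace (p (i - 1)%Z * d1 - q j * d2) with (p (i - 1)%Z * d1 + -1 * (q j * d2)) by ring.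
    replace (p (i + 1)%Z * d1 + q j * d2) with (p (i + 1)%Z * d1 + 1 * (q j * d2)) by ring.
    unfold Rminus; apply Rle_trans with (1 := Rabs_triang _ _).
    rewrite Rabs_Ropp, !Rabs_mult.
    apply Rle_trans with
      ((Rabs (p (i - 1)%Z) * (2 * t) + 1 * (Rabs (q j) * (2 * t))) * Rabs (z (i - 1)%Z j) +
       (Rabs (p (i + 1)%Z) * (2 * t) + 1 * (Rabs (q j) * (2 * t))) * Rabs (z (i + 1)%Z j)).
    - apply Rplus_le_compat; (apply Rmult_le_compat_r; [apply Rabs_pos|assumption]).
    - apply Req_le; ring. }
  rewrite <- pow2_abs.
  assert (H1 := HA (i - 1)%Z); assert (H2 := HA (i + 1)%Z).
  assert (P1 := HA0 (i - 1)%Z); assert (P2 := HA0 (i + 1)%Z).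
  set (A1 := A (i - 1)%Z) in *; set (A2 := A (i + 1)%Z) in *.
  apply Rle_trans with ((2 / INR J * (A1 + A2)) ^ 2).
  - apply pow_incr; split; [apply Rabs_pos|exact HB].
  - apply Rle_trans with (8 / INR J ^ 2 * (A1 ^ 2 + A2 ^ 2)).
    + replace ((2 / INR J * (A1 + A2)) ^ 2) with (4 / INR J ^ 2 * (A1 + A2) ^ 2)
        by (field; lra).
      replace (8 / INR J ^ 2 * (A1 ^ 2 + A2 ^ 2))
        with (4 / INR J ^ 2 * (2 * (A1 ^ 2 + A2 ^ 2))) by (field; lra).
      apply Rmult_le_compat_l.
      * apply Rlt_le, Rdiv_lt_0_compat; nra.
      * assert (H := pow2_ge_0 (A1 - A2)); lra.
    + apply Rle_trans with (8 / INR J ^ 2 * (6 * INR J * column c kap m J y (i - 1)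
                             + 6 * INR J * column c kap m J y (i + 1))).
      * apply Rmult_le_compat_l; [apply Rlt_le, Rdiv_lt_0_compat; nra|lra].
      * apply Req_le; field; lra.
Qed.

Lemma inverse_square_tail (p : R) (n : nat) :
  1 <= p -> lsum (seq 1 n) (fun l => / (p ^ 2 + INR l ^ 2)) <= 2 / p - 2 / (p + INR n).
Proof.
  intros Hp; induction n as [|n IH].
  - cbn [seq INR]; rewrite lsum_nil, Rplus_0_r; lra.
  - rewrite seq_S, lsum_app, lsum_cons, lsum_nil; cbn [Nat.add].
    set (a := INR n) in *; assert (Ha : 0 <= a) by apply pos_INR.
    rewrite S_INR; fold a.
    assert (/ (p ^ 2 + (a + 1) ^ 2) <= 2 / (p + a) - 2 / (p + (a + 1))).
    { replace (2 / (p + a) - 2 / (p + (a + 1)))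
        with (/ ((p + a) * (p + a + 1) / 2)) by (field; lra).
      assert (Hs := pow2_ge_0 (p - a - / 2)).
      apply Rinv_le_contravar; [|lra].
      apply Rdiv_lt_0_compat; [apply Rmult_lt_0_compat|]; lra. }
    lra.
Qed.

Lemma inverse_square_sum (p : R) (L : nat) :
  1 <= p -> lsum (zrange L) (fun l => / (p ^ 2 + IZR l ^ 2)) <= 5 / p.
Proof.
  intros Hp.
  set (f := fun l : nat => / (p ^ 2 + INR l ^ 2)).
  apply Rle_trans with (lsum (0%Z :: map Z.of_nat (seq 1 L) ++ map (fun n => - Z.of_nat n)%Z (seq 1 L))
                          (fun l => / (p ^ 2 + IZR l ^ 2))).
  - apply lsum_incl_le; [apply NoDup_zrange| |].
    + intros l Hl; apply in_zrange in Hl; cbn [In].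
      destruct (Z_dec 0 l) as [[H|H]|H]; [right|right|now left]; apply in_or_app;
        [left|right]; apply in_map_iff; exists (Z.to_nat (Z.abs l));
        (split; [lia|apply in_seq; lia]).
    + intros l; assert (H := pow2_ge_0 (IZR l)); apply Rlt_le, Rinv_0_lt_compat; nra.
  - rewrite lsum_cons, lsum_app, !lsum_map.
    rewrite (lsum_ext _ (fun a => / (p ^ 2 + IZR (Z.of_nat a) ^ 2)) f)
      by (intros; unfold f; now rewrite <- INR_IZR_INZ).
    rewrite (lsum_ext _ (fun a => / (p ^ 2 + IZR (- Z.of_nat a) ^ 2)) f)
      by (intros; unfold f; rewrite opp_IZR, <- INR_IZR_INZ; f_equal; ring).
    assert (H := inverse_square_tail p L Hp); fold f in H.
    assert (0 < 2 / (p + INR L))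
      by (apply Rdiv_lt_0_compat; [lra|]; assert (H0 := pos_INR L); lra).
    assert (/ (p ^ 2 + 0 ^ 2) <= / p) by (apply Rinv_le_contravar; nra).
    unfold Rdiv in *; lra.
Qed.

Lemma trace_weight (c kap m : Z) (J : nat) (y : mode -> R) (i : Z) :
  (0 < J)%nat -> (0 < m)%Z -> (c + m * i <> 0)%Z ->
  Rabs (IZR (c + m * i)) * trace c kap m J y i ^ 2 <= 5 * column c kap m J y i.
Proof.
  intros HJ Hm Hp; set (p := (c + m * i)%Z) in *.
  assert (Hp1 : 1 <= Rabs (IZR p)) by (rewrite <- abs_IZR; apply IZR_le; lia).
  assert (Hpp : forall l : Z, 1 <= IZR p ^ 2 + IZR l ^ 2).
  { intros l; rewrite <- (pow2_abs (IZR p)); assert (H := pow2_ge_0 (IZR l)); nra. }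
  set (D := lsum (zrange J) (fun j => / (IZR p ^ 2 + IZR (kap + m * j) ^ 2))).
  assert (HD : D <= 5 / Rabs (IZR p)).
  { unfold D; rewrite <- (pow2_abs (IZR p)).
    apply Rle_trans with (2 := inverse_square_sum _ (Z.to_nat (Z.abs kap + m * Z.of_nat J)) Hp1).
    apply (lsum_inj_le (fun j => kap + m * j)%Z (zrange J) _
             (fun l => / (Rabs (IZR p) ^ 2 + IZR l ^ 2))).
    - apply NoDup_zrange.
    - intros a b; nia.
    - intros a; rewrite !in_zrange; nia.
    - intros l; rewrite pow2_abs; apply Rlt_le, Rinv_0_lt_compat; assert (H := Hpp l); lra. }
  assert (HT : trace c kap m J y i ^ 2 <= column c kap m J y i * D).
  { unfold trace, column; fold p.
    set (s := fun j => sqrt (IZR p ^ 2 + IZR (kap + m * j) ^ 2)).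
    assert (Hs : forall j, 0 < s j) by (intros j; apply sqrt_lt_R0; assert (H := Hpp (kap + m * j)%Z); lra).
    assert (Hs2 : forall j, s j ^ 2 = IZR p ^ 2 + IZR (kap + m * j) ^ 2).
    { intros j; unfold s; rewrite <- Rsqr_pow2; apply Rsqr_sqrt.
      assert (H := Hpp (kap + m * j)%Z); lra. }
    rewrite (lsum_ext _ _ (fun j => (tent J j * (s j * y (p, kap + m * j)%Z)) * / s j))
      by (intros j _; field; apply Rgt_not_eq, Hs).
    apply Rle_trans with (1 := lsum_cauchy _ _ _).
    apply Rmult_le_compat; try (apply lsum_nonneg; intros; apply pow2_ge_0).
    - apply lsum_le; intros j _; unfold sq; cbn [fst snd].
      rewrite <- (Hs2 j), <- Rpow_mult_distr, (Rpow_mult_distr (tent J j)).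
      rewrite <- (Rmult_1_l ((s j * _) ^ 2)) at 2.
      apply Rmult_le_compat_r; [apply pow2_ge_0|].
      assert (H := tent_bound J j HJ); nra.
    - apply Req_le, lsum_ext; intros j _; rewrite <- (Hs2 j), pow_inv; reflexivity. }
  assert (HC : 0 <= column c kap m J y i).
  { apply lsum_nonneg; intros j _; apply Rmult_le_pos; [apply sq_nonneg|apply pow2_ge_0]. }
  apply Rle_trans with (Rabs (IZR p) * (column c kap m J y i * (5 / Rabs (IZR p)))).
  - apply Rmult_le_compat_l; [lra|]; apply Rle_trans with (1 := HT).
    now apply Rmult_le_compat_l.
  - apply Req_le; field; lra.
Qed.

Definition grad_sum (L : nat) (y : mode -> R) : R := lsum (box L) (fun k => sq k * y k ^ 2).
Definition mass_sum (L : nat) (y : mode -> R) : R := lsum (box L) (fun k => y k ^ 2).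

Definition window (c kap m : Z) (R0 J : nat) : nat :=
  Z.to_nat (Z.abs c + Z.abs kap + Z.abs m * (Z.of_nat R0 + Z.of_nat J)).

Lemma in_window (c kap m : Z) (R0 J L : nat) (i j : Z) :
  (window c kap m R0 J <= L)%nat ->
  (Z.abs i <= Z.of_nat R0)%Z -> (Z.abs j <= Z.of_nat J)%Z ->
  In (c + m * i, kap + m * j)%Z (box L).
Proof.
  unfold window; intros HL Hi Hj; apply in_box; cbn [fst snd].
  assert (Z.abs (m * i) <= Z.abs m * Z.of_nat R0)%Z by (rewrite Z.abs_mul; nia).
  assert (Z.abs (m * j) <= Z.abs m * Z.of_nat J)%Z by (rewrite Z.abs_mul; nia).
  lia.
Qed.

Lemma columns_le_grad (c kap m : Z) (R0 J L : nat) (y : mode -> R) :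
  (0 < m)%Z -> (window c kap m R0 J <= L)%nat ->
  lsum (zrange R0) (column c kap m J y) <= grad_sum L y.
Proof.
  intros Hm HL; unfold column, grad_sum.
  set (f := fun k : mode => sq k * y k ^ 2).
  assert (E := lsum_prod (zrange R0) (zrange J)
    (fun ij : Z * Z => f (c + m * fst ij, kap + m * snd ij)%Z)).
  cbn [fst snd] in E; unfold f at 2 in E; rewrite <- E.
  apply (lsum_inj_le (fun ij : Z * Z => (c + m * fst ij, kap + m * snd ij)%Z)).
  - apply NoDup_list_prod; apply NoDup_zrange.
  - intros [a b] [a' b'] E1; cbn [fst snd] in E1; inversion E1; f_equal; nia.
  - intros [a b] Hab; apply in_prod_iff in Hab; rewrite !in_zrange in Hab.
    apply (in_window c kap m R0 J); [assumption| |]; cbn [fst snd]; lia.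
  - intros k; apply Rmult_le_pos; [apply sq_nonneg|apply pow2_ge_0].
Qed.

Lemma column_nonneg (c kap m : Z) (J : nat) (y : mode -> R) (i : Z) :
  0 <= column c kap m J y i.
Proof.
  apply lsum_nonneg; intros; apply Rmult_le_pos; [apply sq_nonneg|apply pow2_ge_0].
Qed.

Lemma column_le_grad (c kap m : Z) (R0 J L : nat) (y : mode -> R) (i : Z) :
  (0 < m)%Z -> (window c kap m R0 J <= L)%nat -> (Z.abs i <= Z.of_nat R0)%Z ->
  column c kap m J y i <= grad_sum L y.
Proof.
  intros Hm HL Hi; apply Rle_trans with (2 := columns_le_grad c kap m R0 J L y Hm HL).
  apply lsum_elem_le; [intros; apply column_nonneg|apply in_zrange; lia].
Qed.

Lemma tent_sum_sqr (c kap m : Z) (R0 J L : nat) (y s : mode -> R) (i : Z) (Cs : R) :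
  (0 < J)%nat -> (0 < m)%Z -> (window c kap m R0 J <= L)%nat -> (Z.abs i <= Z.of_nat R0)%Z ->
  (forall k, In k (box (window c kap m R0 J)) -> Rabs (s k) <= Cs) ->
  (lsum (zrange J) (fun j => tent J j *
     (s (c + m * i, kap + m * j)%Z * y (c + m * i, kap + m * j)%Z))) ^ 2
  <= (2 * INR J + 1) * Cs ^ 2 * mass_sum L y.
Proof.
  intros HJ Hm HL Hi Hs.
  apply Rle_trans with (1 := lsum_sqr_le _ _).
  rewrite length_zrange, plus_INR, mult_INR; cbn [INR].
  rewrite Rmult_assoc; apply Rmult_le_compat_l.
  { assert (H := pos_INR J); lra. }
  apply Rle_trans with
    (lsum (zrange J) (fun j => Cs ^ 2 * y (c + m * i, kap + m * j)%Z ^ 2)).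
  - apply lsum_le; intros j Hj; apply in_zrange in Hj.
    rewrite !Rpow_mult_distr.
    assert (Ht := tent_bound J j HJ).
    assert (Hs' := Hs _ (in_window c kap m R0 J _ i j (le_n _) Hi ltac:(lia))).
    rewrite <- (pow2_abs (s _)).
    set (a := Rabs (s _)) in *; assert (0 <= a) by apply Rabs_pos.
    set (b := y _ ^ 2); assert (0 <= b) by apply pow2_ge_0.
    rewrite <- Rmult_assoc; apply Rmult_le_compat_r; [assumption|].
    rewrite <- Rpow_mult_distr; apply pow_incr; nra.
  - rewrite lsum_scal; apply Rmult_le_compat_l; [apply pow2_ge_0|].
    apply (lsum_inj_le (fun j => (c + m * i, kap + m * j)%Z) _ _ (fun k : mode => y k ^ 2)).
    + apply NoDup_zrange.
    + intros a b E; inversion E; nia.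
    + intros j Hj; apply in_zrange in Hj; apply (in_window c kap m R0 J); auto; lia.
    + intros; apply pow2_ge_0.
Qed.

Definition evolves (B g : R) (sig : mode -> R) (m : Z) (x : R -> mode -> R) (a b : R) : Prop :=
  forall t, a <= t <= b -> forall k,
    is_derive (fun s => x s k) t (B * adv m (x t) k - g * (sig k * x t k)).

Lemma evolves_cont (B g : R) (sig : mode -> R) (m : Z) (x : R -> mode -> R) (a b : R) :
  evolves B g sig m x a b -> forall k, cont_on a b (fun t => x t k).
Proof.
  intros H k; apply (is_derive_cont_on a b _ (fun t => B * adv m (x t) k - g * (sig k * x t k))).
  intros t Ht; now apply H.
Qed.

Lemma cont_adv (m : Z) (x : R -> mode -> R) (a b : R) (k : mode) :
  (forall l, cont_on a b (fun t => x t l)) -> cont_on a b (fun t => adv m (x t) k).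
Proof. intros H; unfold adv; cont_tac; apply H. Qed.

Lemma cont_flow_trace (c kap m : Z) (J : nat) (x : R -> mode -> R) (a b : R) (i : Z) :
  (forall l, cont_on a b (fun t => x t l)) ->
  cont_on a b (fun t => flow_trace c kap m J (x t) i).
Proof. intros H; unfold flow_trace, trace; cont_tac; apply H. Qed.

Lemma flow_trace_derive (B g : R) (sig : mode -> R) (m : Z) (x : R -> mode -> R) (a b t : R)
    (c kap : Z) (J : nat) (i : Z) :
  evolves B g sig m x a b -> a <= t <= b ->
  is_derive (fun s => flow_trace c kap m J (x s) i) t
    (IZR (c + m * i) *
      (B * lsum (zrange J) (fun j => tent J j * adv m (x t) (c + m * i, kap + m * j)%Z)
       - g * lsum (zrange J) (fun j => tent J j *
           (sig (c + m * i, kap + m * j)%Z * x t (c + m * i, kap + m * j)%Z)))).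
Proof.
  intros He Ht; unfold flow_trace, trace; apply is_derive_cmul.
  rewrite <- !lsum_scal, <- lsum_minus.
  apply (is_derive_lsum (zrange J) (fun s j => tent J j * x s (c + m * i, kap + m * j)%Z)).
  intros j.
  match goal with |- is_derive _ _ ?d =>
    replace d with (tent J j * (B * adv m (x t) (c + m * i, kap + m * j)%Z
      - g * (sig (c + m * i, kap + m * j)%Z * x t (c + m * i, kap + m * j)%Z))) by ring end.
  apply (is_derive_cmul (fun s => x s (c + m * i, kap + m * j)%Z)); now apply He.
Qed.

Lemma prog_IZR (c m i : Z) : IZR (c + m * i) = prog (IZR c) (IZR m) i.
Proof. unfold prog; now rewrite plus_IZR, mult_IZR. Qed.

Lemma Rabs_mult_le_half (u v w : R) :
  0 < w -> Rabs (u * v) <= / 2 * (w * u ^ 2 + v ^ 2 / w).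
Proof.
  intros Hw.
  assert (H1 := pow2_ge_0 (w * u + v)); assert (H2 := pow2_ge_0 (w * u - v)).
  assert (E : / 2 * (w * u ^ 2 + v ^ 2 / w) = (w ^ 2 * u ^ 2 + v ^ 2) / (2 * w))
    by (field; lra).
  rewrite E; apply Rle_div_r; [lra|].
  rewrite <- (Rabs_pos_eq (2 * w)), <- Rabs_mult by lra.
  apply Rabs_le; split; lra.
Qed.

Lemma trace_relation (g d1 Cs P : R) (sig : mode -> R) (m c kap : Z) (R0 K L : nat)
    (B : R) (x : R -> mode -> R) (a b Y : R) (i : Z) :
  let J := (K * K)%nat in
  let p := fun i => IZR (c + m * i) in
  let S := fun t i => flow_trace c kap m J (x t) i in
  0 <= g -> (0 < m)%Z -> (0 < K)%nat -> (forall j, c + m * j <> 0)%Z ->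
  (forall j, (Z.abs j <= Z.of_nat R0)%Z -> Rabs (p j) <= P) ->
  (forall k, In k (box (window c kap m R0 J)) -> Rabs (sig k) <= Cs) ->
  (window c kap m R0 J <= L)%nat ->
  a <= b -> b - a <= d1 -> B <> 0 -> evolves B g sig m x a b ->
  (forall t, a <= t <= b -> mass_sum L (x t) <= Y) ->
  integral (fun t => grad_sum L (x t)) a b <= Y ->
  (Z.abs i <= Z.of_nat R0 - 2)%Z ->
  Rabs (integral (fun t => p i * (S t (i + 1)%Z ^ 2 - S t (i - 1)%Z * S t (i + 1)%Z)
     - p (i + 1)%Z * (S t i ^ 2 - S t i * S t (i + 2)%Z)) a b)
  <= Y * ((P ^ 2 * (2 * INR J + 1) + d1 * (g * (P * ((2 * INR J + 1) * (P ^ 2 + Cs ^ 2))))) / Rabs B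
          + P * (96 + 5 * P) / INR K).
Proof.
  intros J p S Hg Hm HK Hnz HP Hs HL Hab Hd HB He HY HG Hi.
  assert (HJ : (0 < J)%nat) by (unfold J; nia).
  assert (HK' : 0 < INR K) by (apply lt_0_INR; lia).
  assert (HJK : INR J = INR K ^ 2) by (unfold J; rewrite mult_INR; ring).
  assert (HBa : 0 < Rabs B) by now apply Rabs_pos_lt.
  assert (Hc := evolves_cont _ _ _ _ _ _ _ He).
  assert (HcS : forall j, cont_on a b (fun t => S t j)) by (intros; now apply cont_flow_trace).
  assert (HP0 : 0 <= P) by (apply Rle_trans with (2 := HP i ltac:(lia)); apply Rabs_pos).
  assert (HJ0 : 0 <= INR J) by apply pos_INR.
  set (A := fun t i => lsum (zrange J) (fun j => tent J j * adv m (x t) (c + m * i, kap + m * j)%Z)).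
  set (F := fun t i => lsum (zrange J) (fun j => tent J j *
           (sig (c + m * i, kap + m * j)%Z * x t (c + m * i, kap + m * j)%Z))).
  set (G := fun t => grad_sum L (x t)).
  set (du := fun t => p i * (B * A t i - g * F t i) * S t (i + 1)%Z
                  + S t i * (p (i + 1)%Z * (B * A t (i + 1)%Z - g * F t (i + 1)%Z))).
  assert (HcA : forall j, cont_on a b (fun t => A t j)).
  { intros j; unfold A; cont_tac; apply cont_adv, Hc. }
  assert (HcF : forall j, cont_on a b (fun t => F t j)) by (intros j; unfold F; cont_tac; apply Hc).
  assert (HcG : cont_on a b G) by (unfold G, grad_sum; cont_tac; apply Hc).
  assert (HY0 : 0 <= Y).
  { apply Rle_trans with (2 := HY a ltac:(lra)); apply lsum_nonneg; intros; apply pow2_ge_0. }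
  set (Z1 := (2 * INR J + 1)) in *.
  assert (HTm : forall t j, a <= t <= b -> (Z.abs j <= Z.of_nat R0)%Z -> S t j ^ 2 <= P ^ 2 * (Z1 * Y)).
  { intros t j Ht Hj; unfold S, flow_trace; rewrite Rpow_mult_distr.
    apply Rmult_le_compat; try apply pow2_ge_0.
    - rewrite <- pow2_abs; apply pow_incr; split; [apply Rabs_pos|now apply HP].
    - assert (H := tent_sum_sqr c kap m R0 J L (x t) (fun _ => 1) j 1 HJ Hm HL Hj
        ltac:(intros; cbv beta; rewrite Rabs_R1; lra)).
      unfold trace; rewrite (lsum_ext _ _ (fun j0 => tent J j0 * (1 * x t (c + m * j, kap + m * j0)%Z)))
        by (intros; ring).
      apply Rle_trans with (1 := H); rewrite pow1, Rmult_1_r; unfold Z1.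
      apply Rmult_le_compat_l; [lra|now apply HY]. }
  assert (HTg : forall t j, (Z.abs j <= Z.of_nat R0)%Z -> S t j ^ 2 <= P * (5 * G t)).
  { intros t j Hj; unfold S, flow_trace; rewrite Rpow_mult_distr.
    rewrite <- (pow2_abs (IZR _)).
    replace (Rabs (IZR (c + m * j)) ^ 2 * trace c kap m J (x t) j ^ 2)
      with (Rabs (IZR (c + m * j)) * (Rabs (IZR (c + m * j)) * trace c kap m J (x t) j ^ 2)) by ring.
    apply Rmult_le_compat; [apply Rabs_pos| |now apply HP|].
    - apply Rmult_le_pos; [apply Rabs_pos|apply pow2_ge_0].
    - apply Rle_trans with (1 := trace_weight c kap m J (x t) j HJ Hm (Hnz j)).
      apply Rmult_le_compat_l; [lra|]; now apply (column_le_grad c kap m R0 J L). }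
  assert (HFm : forall t j, a <= t <= b -> (Z.abs j <= Z.of_nat R0)%Z -> F t j ^ 2 <= Z1 * Cs ^ 2 * Y).
  { intros t j Ht Hj; apply Rle_trans with (1 := tent_sum_sqr c kap m R0 J L (x t) sig j Cs HJ Hm HL Hj Hs).
    apply Rmult_le_compat_l; [|now apply HY].
    apply Rmult_le_pos; [unfold Z1; lra|apply pow2_ge_0]. }
  set (er := fun t j => A t j - (2 * S t (j - 1)%Z - 2 * S t (j + 1)%Z)).
  assert (HE : forall t j, (Z.abs j <= Z.of_nat R0 - 1)%Z -> er t j ^ 2 <= 96 / INR K ^ 2 * G t).
  { intros t j Hj.
    apply Rle_trans with (1 := trace_adv_error c kap m J (x t) j HJ).
    rewrite HJK.
    assert (H1 := column_le_grad c kap m R0 J L (x t) (j - 1) Hm HL ltac:(lia)).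
    assert (H2 := column_le_grad c kap m R0 J L (x t) (j + 1) Hm HL ltac:(lia)).
    fold (G t) in H1, H2.
    apply Rle_trans with (48 / INR K ^ 2 * (2 * G t)); [|apply Req_le; field; lra].
    apply Rmult_le_compat_l; [|lra].
    apply Rlt_le, Rdiv_lt_0_compat; [lra|nra]. }
  set (al := P * (96 + 5 * P) / INR K).
  set (be := g * (P * (Z1 * (P ^ 2 + Cs ^ 2))) / Rabs B * Y).
  assert (Hpt : forall t, a <= t <= b ->
    Rabs ((p i * (S t (i + 1)%Z ^ 2 - S t (i - 1)%Z * S t (i + 1)%Z)
     - p (i + 1)%Z * (S t i ^ 2 - S t i * S t (i + 2)%Z)) + / (2 * B) * du t) <= al * G t + be).
  { intros t Ht.
    assert (E : (p i * (S t (i + 1)%Z ^ 2 - S t (i - 1)%Z * S t (i + 1)%Z)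
     - p (i + 1)%Z * (S t i ^ 2 - S t i * S t (i + 2)%Z)) + / (2 * B) * du t =
     / 2 * (p i * (er t i * S t (i + 1)%Z) + p (i + 1)%Z * (er t (i + 1)%Z * S t i))
     - g / (2 * B) * (p i * (F t i * S t (i + 1)%Z) + p (i + 1)%Z * (F t (i + 1)%Z * S t i))).
    { unfold du, er.
      replace (i + 1 - 1)%Z with i by lia; replace (i + 1 + 1)%Z with (i + 2)%Z by lia.
      field; lra. }
    rewrite E; clear E.
    assert (B1 : forall j l, (Z.abs j <= Z.of_nat R0 - 1)%Z -> (Z.abs l <= Z.of_nat R0)%Z ->
       Rabs (p j * (er t j * S t l)) <= al * G t).
    { intros j l Hj Hl; rewrite Rabs_mult.
      assert (H1 := Rabs_mult_le_half (er t j) (S t l) (INR K) HK').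
      assert (H2 := HE t j Hj); assert (H3 := HTg t l Hl).
      assert (H4 : INR K * er t j ^ 2 <= 96 / INR K * G t).
      { apply Rle_trans with (INR K * (96 / INR K ^ 2 * G t));
          [apply Rmult_le_compat_l; lra|apply Req_le; field; lra]. }
      assert (H5 : S t l ^ 2 / INR K <= P * (5 * G t) / INR K)
        by (apply Rmult_le_compat_r; [apply Rlt_le, Rinv_0_lt_compat|]; lra).
      apply Rle_trans with (P * (96 / INR K * G t + P * (5 * G t) / INR K));
        [|unfold al; apply Req_le; field; lra].
      assert (0 <= INR K * er t j ^ 2) by (apply Rmult_le_pos; [lra|apply pow2_ge_0]).
      assert (0 <= S t l ^ 2 / INR K) by (apply Rdiv_le_0_compat; [apply pow2_ge_0|lra]).
      apply Rmult_le_compat; try apply Rabs_pos; [apply HP; lia|].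
      lra. }
    assert (B2 : forall j l, (Z.abs j <= Z.of_nat R0 - 1)%Z -> (Z.abs l <= Z.of_nat R0)%Z ->
       Rabs (p j * (F t j * S t l)) <= P * (Z1 * (P ^ 2 + Cs ^ 2)) * Y).
    { intros j l Hj Hl; rewrite Rabs_mult.
      assert (H1 := Rabs_mult_le_half (F t j) (S t l) 1 ltac:(lra)).
      rewrite Rmult_1_l, Rdiv_1_r in H1.
      assert (H2 := HFm t j Ht ltac:(lia)); assert (H3 := HTm t l Ht Hl).
      apply Rle_trans with (P * ((Z1 * (P ^ 2 + Cs ^ 2)) * Y)); [|apply Req_le; ring].
      assert (0 <= F t j ^ 2) by apply pow2_ge_0.
      assert (0 <= S t l ^ 2) by apply pow2_ge_0.
      apply Rmult_le_compat; try apply Rabs_pos; [apply HP; lia|].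
      lra. }
    assert (C1 := B1 i (i + 1)%Z ltac:(lia) ltac:(lia)).
    assert (C2 := B1 (i + 1)%Z i ltac:(lia) ltac:(lia)).
    assert (D1 := B2 i (i + 1)%Z ltac:(lia) ltac:(lia)).
    assert (D2 := B2 (i + 1)%Z i ltac:(lia) ltac:(lia)).
    set (r1 := p i * (er t i * S t (i + 1)%Z)) in *.
    set (r2 := p (i + 1)%Z * (er t (i + 1)%Z * S t i)) in *.
    set (f1 := p i * (F t i * S t (i + 1)%Z)) in *.
    set (f2 := p (i + 1)%Z * (F t (i + 1)%Z * S t i)) in *.
    assert (Hgb : Rabs (g / (2 * B)) = g / (2 * Rabs B)).
    { unfold Rdiv; rewrite Rabs_mult, (Rabs_pos_eq g), Rabs_inv, Rabs_mult,
        (Rabs_pos_eq 2) by lra; reflexivity. }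
    unfold Rminus; apply Rle_trans with (1 := Rabs_triang _ _).
    rewrite Rabs_Ropp, !Rabs_mult, Hgb, (Rabs_pos_eq (/ 2)) by lra.
    assert (Hgb0 : 0 <= g / (2 * Rabs B)) by (apply Rdiv_le_0_compat; lra).
    apply Rplus_le_compat.
    - assert (H := Rabs_triang r1 r2); lra.
    - apply Rle_trans with (g / (2 * Rabs B) * (2 * (P * (Z1 * (P ^ 2 + Cs ^ 2)) * Y)));
        [|unfold be; apply Req_le; field; lra].
      apply Rmult_le_compat_l; [assumption|].
      assert (H := Rabs_triang f1 f2); lra. }
  assert (Hu : forall t, a <= t <= b -> is_derive (fun s => S s i * S s (i + 1)%Z) t (du t)).
  { intros t Ht; apply (is_derive_prod (fun s => S s i) (fun s => S s (i + 1)%Z));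
      now apply (flow_trace_derive B g sig m x a b). }
  assert (Hcdu : cont_on a b du) by (unfold du; cont_tac; auto).
  assert (Hfin := fun Hf => int_bound_up_to_derivative a b (/ (2 * B)) al be _ _ du G Hab
    Hf Hcdu HcG Hu Hpt).
  cbv beta in Hfin.
  apply Rle_trans with (1 := Hfin ltac:(cont_tac; auto)).
  assert (Hub : forall t, a <= t <= b -> Rabs (S t i * S t (i + 1)%Z) <= P ^ 2 * (Z1 * Y)).
  { intros t Ht; assert (H1 := Rabs_mult_le_half (S t i) (S t (i + 1)%Z) 1 ltac:(lra)).
    rewrite Rmult_1_l, Rdiv_1_r in H1.
    assert (H2 := HTm t i Ht ltac:(lia)); assert (H3 := HTm t (i + 1)%Z Ht ltac:(lia)); lra. }
  assert (U1 : Rabs (/ (2 * B)) * Rabs (S b i * S b (i + 1)%Z - S a i * S a (i + 1)%Z)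
     <= P ^ 2 * Z1 / Rabs B * Y).
  { rewrite Rabs_inv, Rabs_mult, (Rabs_pos_eq 2) by lra.
    apply Rle_trans with (/ (2 * Rabs B) * (2 * (P ^ 2 * (Z1 * Y))));
      [|apply Req_le; field; lra].
    apply Rmult_le_compat_l; [apply Rlt_le, Rinv_0_lt_compat; lra|].
    unfold Rminus; apply Rle_trans with (1 := Rabs_triang _ _); rewrite Rabs_Ropp.
    assert (H1 := Hub a ltac:(lra)); assert (H2 := Hub b ltac:(lra)); lra. }
  assert (U2 : al * integral G a b <= al * Y).
  { apply Rmult_le_compat_l; [|exact HG].
    unfold al; apply Rdiv_le_0_compat; [nra|lra]. }
  assert (Hbe : 0 <= g * (P * (Z1 * (P ^ 2 + Cs ^ 2))) / Rabs B).
  { apply Rdiv_le_0_compat; [|lra].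
    assert (0 <= P ^ 2) by apply pow2_ge_0; assert (0 <= Cs ^ 2) by apply pow2_ge_0.
    repeat apply Rmult_le_pos; unfold Z1; lra. }
  assert (U3 : (b - a) * be <= d1 * be)
    by (apply Rmult_le_compat_r; [unfold be; apply Rmult_le_pos|]; lra).
  apply Rle_trans with (P ^ 2 * Z1 / Rabs B * Y + al * Y + d1 * be); [lra|].
  unfold al, be; apply Req_le; field; lra.
Qed.

Lemma mass_sum_nonneg (L : nat) (y : mode -> R) : 0 <= mass_sum L y.
Proof. apply lsum_nonneg; intros; apply pow2_ge_0. Qed.

Lemma grad_sum_nonneg (L : nat) (y : mode -> R) : 0 <= grad_sum L y.
Proof.
  apply lsum_nonneg; intros; apply Rmult_le_pos; [apply sq_nonneg|apply pow2_ge_0].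
Qed.

Lemma trace_small (g d1 eta : R) (sig : mode -> R) (m c kap : Z) :
  0 <= g -> 0 <= d1 -> 0 < eta -> (1 <= c <= m - 1)%Z ->
  exists J : nat, (0 < J)%nat /\ exists B0 : R, 0 < B0 /\ exists L0 : nat,
  forall B, B0 <= Rabs B -> forall L, (L0 <= L)%nat -> forall x a b Y,
    a <= b -> b - a <= d1 -> evolves B g sig m x a b ->
    (forall t, a <= t <= b -> mass_sum L (x t) <= Y) ->
    integral (fun t => grad_sum L (x t)) a b <= Y ->
    integral (fun t => trace c kap m J (x t) 0 ^ 2) a b <= eta * Y /\
    integral (fun t => trace c kap m J (x t) (-1) ^ 2) a b <= eta * Y.
Proof.
  intros Hg Hd1 Heta Hcm.
  assert (Hm : (0 < m)%Z) by lia.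
  assert (HmR : 0 < IZR m) by now apply IZR_lt.
  assert (HcR : 1 <= IZR c) by (apply IZR_le; lia).
  assert (HcmR : IZR c <= IZR m - 1) by (rewrite <- minus_IZR; apply IZR_le; lia).
  assert (Hnz : forall j, (c + m * j <> 0)%Z) by (intros j E; destruct (Z_lt_le_dec j 0); nia).
  destruct (harm_unbounded (16 * IZR m / eta)) as [R0 HR0].
  set (D := INR R0 * (2 * INR R0 + 1 + IZR m)).
  assert (HD : 0 <= D) by (assert (H := pos_INR R0); apply Rmult_le_pos; lra).
  set (W := (R0 + 4)%nat).
  set (P := IZR c + IZR m * INR W).
  assert (HP0 : 0 <= P) by (assert (H := pos_INR W); unfold P; nra).
  assert (HP : forall j, (Z.abs j <= Z.of_nat W)%Z -> Rabs (IZR (c + m * j)) <= P).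
  { intros j Hj; clear - Hcm Hj; rewrite <- abs_IZR; unfold P; rewrite INR_IZR_INZ, <- mult_IZR, <- plus_IZR.
    apply IZR_le.
    assert (Z.abs (m * j) <= m * Z.of_nat W)%Z by (rewrite Z.abs_mul, (Z.abs_eq m); nia); lia. }
  set (C2 := P * (96 + 5 * P)).
  assert (HC2 : 0 <= C2) by (unfold C2; nra).
  destruct (INR_unbounded (2 * (D + 1) * C2)) as [K0 HK0].
  set (K := S K0); set (J := (K * K)%nat).
  assert (HK : 0 < INR K) by (apply lt_0_INR; unfold K; lia).
  assert (HKK : 2 * (D + 1) * C2 <= INR K) by (unfold K; rewrite S_INR; lra).
  set (Lw := window c kap m W J).
  set (Cs := lsum (box Lw) (fun k => Rabs (sig k))).
  assert (HCs : forall k, In k (box Lw) -> Rabs (sig k) <= Cs).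
  { intros k Hk; apply (lsum_elem_le (box Lw) (fun k => Rabs (sig k))); auto.
    intros; apply Rabs_pos. }
  set (C1 := P ^ 2 * (2 * INR J + 1) + d1 * (g * (P * ((2 * INR J + 1) * (P ^ 2 + Cs ^ 2))))).
  assert (HC1 : 0 <= C1).
  { assert (HJ := pos_INR J); assert (H1 := pow2_ge_0 P); assert (H2 := pow2_ge_0 Cs).
    unfold C1; apply Rplus_le_le_0_compat; repeat apply Rmult_le_pos; lra. }
  exists J; split; [unfold J, K; nia|].
  exists (2 * (D + 1) * C1 + 1); split; [nra|].
  exists Lw; intros B HB L HL x a b Y Hab Hd He HY HG.
  assert (HB0 : B <> 0).
  { intros ->; rewrite Rabs_R0 in HB; assert (0 <= 2 * (D + 1) * C1) by nra; lra. }
  assert (HBa : 0 < Rabs B) by now apply Rabs_pos_lt.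
  assert (HY0 : 0 <= Y).
  { apply Rle_trans with (2 := HY a ltac:(lra)); apply mass_sum_nonneg. }
  assert (Hc := evolves_cont _ _ _ _ _ _ _ He).
  set (T := fun t i => trace c kap m J (x t) i).
  set (Sf := fun t i => flow_trace c kap m J (x t) i).
  assert (HcT : forall i, cont_on a b (fun t => T t i))
    by (intros i; unfold T, trace; cont_tac; apply Hc).
  assert (HcS : forall i, cont_on a b (fun t => Sf t i))
    by (intros i; now apply cont_flow_trace).
  assert (HcG : cont_on a b (fun t => grad_sum L (x t)))
    by (unfold grad_sum; cont_tac; apply Hc).
  set (X := fun i => integral (fun t => Rabs (IZR (c + m * i)) * T t i ^ 2) a b).
  set (h := fun i => integral (fun t => Sf t (i - 1)%Z * Sf t (i + 1)%Z) a b).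
  assert (HX : forall i, 0 <= X i).
  { intros i; apply int_nonneg; auto; [cont_tac; auto|]; intros.
    apply Rmult_le_pos; [apply Rabs_pos|apply pow2_ge_0]. }
  assert (He2 : forall i, Rabs (prog (IZR c) (IZR m) i) * X i =
                          integral (fun t => Sf t i ^ 2) a b).
  { intros i; rewrite <- prog_IZR; unfold X; rewrite <- int_scal by (auto; cont_tac; auto).
    apply int_ext; intros t; unfold Sf, flow_trace; fold (T t i).
    rewrite Rpow_mult_distr, <- (pow2_abs (IZR (c + m * i))); ring. }
  set (w := Y / (D + 1)).
  assert (Hw0 : 0 <= w) by (apply Rdiv_le_0_compat; lra).
  assert (Hmain := relation_bound (IZR c) (IZR m) w (5 * Y) X h R0).
  cbv zeta beta in Hmain; rewrite !He2 in Hmain.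
  assert (Hconc : (integral (fun t => Sf t (-1)%Z ^ 2) a b + integral (fun t => Sf t 0%Z ^ 2) a b)
      * harm R0 <= IZR m * (3 * (5 * Y) + INR R0 * ((2 * INR R0 + 1 + IZR m) * w))).
  { apply Hmain; auto; clear Hmain.
    - intros i; rewrite !He2; unfold h.
      set (u := fun t => Sf t (i - 1)%Z); set (v := fun t => Sf t (i + 1)%Z).
      assert (Hu : cont_on a b u) by apply HcS; assert (Hv : cont_on a b v) by apply HcS.
      assert (E : integral (fun t => / 2 * (u t ^ 2 + v t ^ 2)) a b =
        / 2 * (integral (fun t => u t ^ 2) a b + integral (fun t => v t ^ 2) a b)).
      { rewrite int_scal, int_plus by (auto; cont_tac); reflexivity. }
      assert (E' : integral (fun t => - / 2 * (u t ^ 2 + v t ^ 2)) a b =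
        - / 2 * (integral (fun t => u t ^ 2) a b + integral (fun t => v t ^ 2) a b)).
      { rewrite int_scal, int_plus by (auto; cont_tac); reflexivity. }
      change (fun t => Sf t (i - 1)%Z ^ 2) with (fun t => u t ^ 2).
      change (fun t => Sf t (i + 1)%Z ^ 2) with (fun t => v t ^ 2).
      change (fun t => Sf t (i - 1)%Z * Sf t (i + 1)%Z) with (fun t => u t * v t).
      split.
      + apply Rle_trans with (integral (fun t => - / 2 * (u t ^ 2 + v t ^ 2)) a b);
          [rewrite E'; lra|].
        apply int_le; auto; try cont_tac; intros t _.
        assert (H := pow2_ge_0 (u t + v t)); lra.
      + apply Rle_trans with (integral (fun t => / 2 * (u t ^ 2 + v t ^ 2)) a b);
          [|rewrite E; lra].
        apply int_le; auto; try cont_tac; intros t _.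
        assert (H := pow2_ge_0 (u t - v t)); lra.
    - intros i Hi; rewrite !He2; unfold h.
      replace (i + 1 - 1)%Z with i by lia; replace (i + 1 + 1)%Z with (i + 2)%Z by lia.
      rewrite <- !prog_IZR, <- !int_minus by (auto; cont_tac; auto).
      rewrite <- !int_scal by (auto; cont_tac; auto).
      rewrite <- int_minus by (auto; cont_tac; auto).
      assert (HWi : (Z.abs i <= Z.of_nat W - 2)%Z) by (unfold W; lia).
      assert (Hr := trace_relation g d1 Cs P sig m c kap W K L B x a b Y i Hg Hm
        ltac:(unfold K; lia) Hnz HP HCs HL Hab Hd HB0 He HY HG HWi).
      fold J in Hr; apply Rle_trans with (1 := Hr); fold C1 C2.
      unfold w, Rdiv; apply Rmult_le_compat_l; [assumption|].
      assert (B1 : C1 * / Rabs B <= / (2 * (D + 1))).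
      { replace (/ (2 * (D + 1))) with (1 * / (2 * (D + 1))) by ring.
        apply Rle_div_l; [assumption|].
        apply Rle_trans with (C1 * (2 * (D + 1)) * / (2 * (D + 1))); [apply Req_le; field; lra|].
        replace (1 * / (2 * (D + 1)) * Rabs B) with (Rabs B * / (2 * (D + 1))) by ring.
        apply Rmult_le_compat_r; [apply Rlt_le, Rinv_0_lt_compat|]; lra. }
      assert (B2 : C2 * / INR K <= / (2 * (D + 1))).
      { apply Rle_div_l; [assumption|].
        apply Rle_trans with (C2 * (2 * (D + 1)) * / (2 * (D + 1))); [apply Req_le; field; lra|].
        rewrite (Rmult_comm (/ _) (INR K)).
        apply Rmult_le_compat_r; [apply Rlt_le, Rinv_0_lt_compat|]; lra. }
      apply Rle_trans with (/ (2 * (D + 1)) + / (2 * (D + 1))); [lra|].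
      apply Req_le; field; lra.
    - unfold X; rewrite <- (int_lsum a b (zrange (R0 + 2))
        (fun t i => Rabs (IZR (c + m * i)) * T t i ^ 2)) by (auto; intros; cont_tac; auto).
      apply Rle_trans with (integral (fun t => 5 * grad_sum L (x t)) a b).
      + apply int_le; auto; [cont_tac; auto|cont_tac|].
        intros t Ht.
        apply Rle_trans with (5 * lsum (zrange (R0 + 2)) (column c kap m J (x t))).
        * rewrite <- lsum_scal; apply lsum_le; intros i _.
          apply trace_weight; auto; unfold J, K; nia.
        * apply Rmult_le_compat_l; [lra|]; apply columns_le_grad; [assumption|].
          apply Nat.le_trans with (2 := HL); unfold Lw, window, W; nia.
      + rewrite int_scal by (auto; cont_tac); lra. }
  assert (Hrhs : IZR m * (3 * (5 * Y) + INR R0 * ((2 * INR R0 + 1 + IZR m) * w)) <= IZR m * (16 * Y)).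
  { apply Rmult_le_compat_l; [lra|].
    replace (INR R0 * ((2 * INR R0 + 1 + IZR m) * w)) with (D * w) by (unfold D; ring).
    enough (D * w <= Y) by lra.
    unfold w; apply Rle_trans with ((D + 1) * (Y / (D + 1))); [|apply Req_le; field; lra].
    apply Rmult_le_compat_r; [assumption|lra]. }
  assert (Hharm : 0 < 16 * IZR m / eta) by (apply Rdiv_lt_0_compat; lra).
  assert (HS : forall i, (c + m * i <> 0)%Z ->
    0 <= integral (fun t => T t i ^ 2) a b <= integral (fun t => Sf t i ^ 2) a b).
  { intros i Hi; split.
    - apply int_nonneg; auto; [cont_tac; auto|]; intros; apply pow2_ge_0.
    - apply int_le; auto; try (cont_tac; auto).
      intros t _; unfold Sf, flow_trace; fold (T t i).
      rewrite Rpow_mult_distr.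
      assert (1 <= IZR (c + m * i) ^ 2).
      { rewrite <- pow2_abs, <- abs_IZR, <- (pow1 2); apply pow_incr; split; [lra|].
        apply IZR_le; lia. }
      assert (0 <= T t i ^ 2) by apply pow2_ge_0; nra. }
  assert (H0 := HS 0%Z (Hnz _)); assert (H1 := HS (-1)%Z (Hnz _)).
  set (e0 := integral (fun t => Sf t 0%Z ^ 2) a b) in *.
  set (e1 := integral (fun t => Sf t (-1)%Z ^ 2) a b) in *.
  assert (Hfin : e1 + e0 <= eta * Y).
  { apply Rmult_le_reg_r with (16 * IZR m / eta); [assumption|].
    apply Rle_trans with ((e1 + e0) * harm R0); [apply Rmult_le_compat_l; lra|].
    apply Rle_trans with (1 := Hconc); apply Rle_trans with (1 := Hrhs).
    apply Req_le; field; lra. }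
  split; [apply Rle_trans with e0|apply Rle_trans with e1]; (apply H0 || apply H1 || lra).
Qed.

(** * Low modes *)

Definition swap (y : mode -> R) : mode -> R := fun k => y (snd k, fst k).

Lemma box_swap (L : nat) (f : mode -> R) :
  lsum (box L) (fun k => f (snd k, fst k)) = lsum (box L) f.
Proof.
  set (s := fun k : mode => (snd k, fst k) : mode).
  transitivity (lsum (map s (box L)) f); [symmetry; exact (lsum_map s (box L) f)|].
  apply lsum_supp.
  - apply Injective_map_NoDup; [|apply NoDup_box].
    intros [a b] [a' b'] E; inversion E; reflexivity.
  - apply NoDup_box.
  - intros [a b] _; rewrite in_map_iff; split.
    + intros ([a' b'] & E & H); inversion E; subst; apply in_box in H; apply in_box; cbn in *; tauto.
    + intros H; exists (b, a); split; [reflexivity|]; apply in_box in H; apply in_box; cbn in *; tauto.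
Qed.

Lemma mass_sum_swap (L : nat) (y : mode -> R) : mass_sum L (swap y) = mass_sum L y.
Proof. exact (box_swap L (fun k => y k ^ 2)). Qed.

Lemma grad_sum_swap (L : nat) (y : mode -> R) : grad_sum L (swap y) = grad_sum L y.
Proof.
  unfold grad_sum; rewrite <- (box_swap L (fun k => sq k * y k ^ 2)); apply lsum_ext.
  intros k _; unfold swap, sq; cbn [fst snd]; ring.
Qed.

Lemma adv_swap (m : Z) (y : mode -> R) (k : mode) :
  adv m (swap y) k = - adv m y (snd k, fst k).
Proof. unfold adv, swap; cbn [fst snd]; ring. Qed.

Lemma evolves_swap (B g : R) (sig : mode -> R) (m : Z) (x : R -> mode -> R) (a b : R) :
  evolves B g sig m x a b -> evolves (- B) g (swap sig) m (fun t => swap (x t)) a b.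
Proof.
  intros H t Ht k; rewrite adv_swap.
  replace (- B * - adv m (x t) (snd k, fst k)) with (B * adv m (x t) (snd k, fst k)) by ring.
  exact (H t Ht (snd k, fst k)).
Qed.

Definition line (L : nat) (y : mode -> R) (k1 : Z) : R :=
  lsum (zrange L) (fun l => sq (k1, l) * y (k1, l) ^ 2).

Lemma line_nonneg (L : nat) (y : mode -> R) (k1 : Z) : 0 <= line L y k1.
Proof. apply lsum_nonneg; intros; apply Rmult_le_pos; [apply sq_nonneg|apply pow2_ge_0]. Qed.

Lemma lines_le_grad (h L : nat) (y : mode -> R) :
  (h <= L)%nat -> lsum (zrange h) (line L y) <= grad_sum L y.
Proof.
  intros H; unfold grad_sum, box, mode; rewrite lsum_prod.
  apply (lsum_incl_le (zrange h) (zrange L) (line L y)).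
  - apply NoDup_zrange.
  - intros i; rewrite !in_zrange; lia.
  - intros; apply line_nonneg.
Qed.

Lemma low_mode_pointwise (m k1 k2 : Z) (J L : nat) (y : mode -> R) :
  (0 < m)%Z -> (0 < J)%nat -> (2 * Z.abs k2 <= m)%Z -> (Z.abs k2 + m * Z.of_nat J <= Z.of_nat L)%Z ->
  y (k1, k2) ^ 2 <= 2 * lsum (zrange J) (fun j => tent J j * y (k1, k2 + m * j)%Z) ^ 2
                    + 80 / IZR m ^ 2 * line L y k1.
Proof.
  intros Hm HJ Hk HL.
  assert (HmR : 0 < IZR m) by now apply IZR_lt.
  set (f := fun j => if Z.eq_dec j 0 then 0 else IZR (k2 + m * j) * y (k1, k2 + m * j)%Z).
  set (g := fun j => if Z.eq_dec j 0 then 0 else tent J j / IZR (k2 + m * j)).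
  set (T := lsum (zrange J) (fun j => tent J j * y (k1, k2 + m * j)%Z)).
  assert (Hq : forall j, j <> 0%Z -> (m * Z.abs j <= 2 * Z.abs (k2 + m * j))%Z).
  { intros j Hj; assert (Z.abs (m * j) = m * Z.abs j)%Z by (rewrite Z.abs_mul; lia).
    assert (m <= m * Z.abs j)%Z by nia. lia. }
  assert (Hq0 : forall j, j <> 0%Z -> IZR (k2 + m * j) <> 0).
  { intros j Hj E; apply eq_IZR in E; specialize (Hq j Hj); rewrite E in Hq.
    assert (0 < m * Z.abs j)%Z by nia; lia. }
  assert (HT : T = y (k1, k2) + lsum (zrange J) (fun j => f j * g j)).
  { transitivity (lsum (zrange J) (fun j => (if Z.eq_dec j 0 then y (k1, k2) else 0) + f j * g j)).
    - apply lsum_ext; intros j _; unfold f, g; destruct (Z.eq_dec j 0) as [->|Hj].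
      + rewrite tent_0, Z.mul_0_r, Z.add_0_r; ring.
      + field; now apply Hq0.
    - rewrite lsum_plus; f_equal.
      rewrite (lsum_supp (zrange J) [0%Z]).
      + rewrite lsum_cons, lsum_nil; destruct (Z.eq_dec 0 0); [ring|lia].
      + apply NoDup_zrange.
      + constructor; [intros []|constructor].
      + intros j; destruct (Z.eq_dec j 0) as [->|]; [|tauto]; intros _.
        rewrite in_zrange; cbn [In]; split; [auto|lia]. }
  set (rest := lsum (zrange J) (fun j => f j * g j)) in *.
  assert (Hrest : rest ^ 2 <= line L y k1 * (40 / IZR m ^ 2)).
  { apply Rle_trans with (1 := lsum_cauchy _ _ _).
    apply Rmult_le_compat; try (apply lsum_nonneg; intros; apply pow2_ge_0).
    - apply Rle_trans with (lsum (zrange J) (fun j => sq (k1, k2 + m * j)%Z * y (k1, k2 + m * j)%Z ^ 2)).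
      + apply lsum_le; intros j _; unfold f, sq; cbn [fst snd].
        assert (0 <= y (k1, k2 + m * j)%Z ^ 2) by apply pow2_ge_0.
        assert (0 <= IZR k1 ^ 2) by apply pow2_ge_0.
        assert (0 <= IZR (k2 + m * j) ^ 2) by apply pow2_ge_0.
        destruct (Z.eq_dec j 0); [rewrite pow_i by lia; apply Rmult_le_pos; lra|].
        rewrite Rpow_mult_distr; apply Rmult_le_compat_r; lra.
      + apply (lsum_inj_le (fun j => k2 + m * j)%Z (zrange J) (zrange L)
                 (fun l => sq (k1, l) * y (k1, l) ^ 2)).
        * apply NoDup_zrange.
        * intros a b; nia.
        * intros j; rewrite !in_zrange; nia.
        * intros; apply Rmult_le_pos; [apply sq_nonneg|apply pow2_ge_0].
    - apply Rle_trans with (lsum (zrange J) (fun j => 8 / IZR m ^ 2 * / (1 ^ 2 + IZR j ^ 2))).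
      + apply lsum_le; intros j _; unfold g.
        assert (Hj2 : 0 <= IZR j ^ 2) by apply pow2_ge_0.
        destruct (Z.eq_dec j 0) as [|Hj].
        * rewrite pow_i by lia; apply Rmult_le_pos;
            [apply Rlt_le, Rdiv_lt_0_compat; nra|apply Rlt_le, Rinv_0_lt_compat; lra].
        * specialize (Hq j Hj); apply IZR_le in Hq.
          rewrite !mult_IZR, !abs_IZR in Hq.
          assert (Hj1 : 1 <= Rabs (IZR j)) by (rewrite <- abs_IZR; apply IZR_le; lia).
          assert (Ht := tent_bound J j HJ).
          set (q := IZR (k2 + m * j)) in *.
          rewrite <- (pow2_abs (IZR j)).
          rewrite <- (pow2_abs (tent J j / q)), Rabs_div by now apply Hq0.
          rewrite (Rabs_pos_eq (tent J j)) by lra.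
          set (u := Rabs (IZR j)) in *; set (v := Rabs q) in *.
          assert (Hv : 0 < v) by nra.
          assert (H1 : (tent J j / v) ^ 2 <= (1 / v) ^ 2).
          { apply pow_incr; split; [apply Rdiv_le_0_compat; lra|].
            apply Rmult_le_compat_r; [apply Rlt_le, Rinv_0_lt_compat|]; lra. }
          apply Rle_trans with (1 := H1).
          replace ((1 / v) ^ 2) with (/ (v ^ 2)) by (field; lra).
          replace (8 / IZR m ^ 2 * / (1 ^ 2 + u ^ 2)) with (/ (IZR m ^ 2 * (1 + u ^ 2) / 8))
            by (field; split; nra).
          assert (Hmu : (IZR m * u) * (IZR m * u) <= (2 * v) * (2 * v))
            by (apply Rmult_le_compat; nra).
          apply Rinv_le_contravar; [apply Rdiv_lt_0_compat; nra|].
          assert (IZR m ^ 2 * 1 <= IZR m ^ 2 * u ^ 2)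
            by (apply Rmult_le_compat_l; nra).
          lra.
      + rewrite lsum_scal.
        assert (H := inverse_square_sum 1 J ltac:(lra)).
        apply Rle_trans with (8 / IZR m ^ 2 * (5 / 1)); [|apply Req_le; field; lra].
        apply Rmult_le_compat_l; [apply Rlt_le, Rdiv_lt_0_compat; nra|assumption]. }
  replace (80 / IZR m ^ 2 * line L y k1) with (2 * (line L y k1 * (40 / IZR m ^ 2))) by (field; lra).
  replace (y (k1, k2)) with (T - rest) by lra.
  assert (H := pow2_ge_0 (T + rest)); lra.
Qed.

Lemma low_mode_column (g d1 eta : R) (sig : mode -> R) (m k1 k2 : Z) :
  0 <= g -> 0 <= d1 -> 0 < eta ->
  (k1 <> 0)%Z -> (2 * Z.abs k1 <= m)%Z -> (2 * Z.abs k2 <= m)%Z ->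
  exists B0 : R, exists L0 : nat,
  forall B, B0 <= Rabs B -> forall L, (L0 <= L)%nat -> forall x a b Y,
    a <= b -> b - a <= d1 -> evolves B g sig m x a b ->
    (forall t, a <= t <= b -> mass_sum L (x t) <= Y) ->
    integral (fun t => grad_sum L (x t)) a b <= Y ->
    integral (fun t => x t (k1, k2) ^ 2) a b <=
      eta * Y + 80 / IZR m ^ 2 * integral (fun t => line L (x t) k1) a b.
Proof.
  intros Hg Hd1 Heta Hk1 Hk1m Hk2.
  set (c := if Z_lt_le_dec 0 k1 then k1 else (k1 + m)%Z).
  set (i0 := if Z_lt_le_dec 0 k1 then 0%Z else (-1)%Z).
  assert (Hc : (1 <= c <= m - 1)%Z) by (unfold c; destruct (Z_lt_le_dec 0 k1); lia).
  assert (Hci : (c + m * i0 = k1)%Z) by (unfold c, i0; destruct (Z_lt_le_dec 0 k1); lia).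
  destruct (trace_small g d1 (eta / 2) sig m c k2 Hg Hd1 ltac:(lra) Hc)
    as (J & HJ & B0 & HB0 & L0 & Htr).
  exists B0, (Nat.max L0 (Z.to_nat (Z.abs k2 + m * Z.of_nat J))).
  intros B HB L HL x a b Y Hab Hd He HY HG.
  assert (Hco := evolves_cont _ _ _ _ _ _ _ He).
  destruct (Htr B HB L ltac:(lia) x a b Y Hab Hd He HY HG) as [T0 T1].
  assert (HT : integral (fun t => trace c k2 m J (x t) i0 ^ 2) a b <= eta / 2 * Y)
    by (unfold i0; destruct (Z_lt_le_dec 0 k1); assumption).
  assert (HcT : cont_on a b (fun t => trace c k2 m J (x t) i0))
    by (unfold trace; cont_tac; apply Hco).
  assert (Hcl : cont_on a b (fun t => line L (x t) k1)) by (unfold line; cont_tac; apply Hco).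
  apply Rle_trans with (integral (fun t => 2 * trace c k2 m J (x t) i0 ^ 2
    + 80 / IZR m ^ 2 * line L (x t) k1) a b).
  - apply int_le; auto; [cont_tac; apply Hco|cont_tac|].
    intros t _; unfold trace; rewrite Hci.
    apply low_mode_pointwise; auto; lia.
  - rewrite int_plus, !int_scal by (auto; cont_tac); lra.
Qed.

Lemma low_mode (g d1 eta : R) (sig : mode -> R) (m k1 k2 : Z) :
  0 <= g -> 0 <= d1 -> 0 < eta ->
  (2 * Z.abs k1 <= m)%Z -> (2 * Z.abs k2 <= m)%Z ->
  exists B0 : R, exists L0 : nat,
  forall B, B0 <= Rabs B -> forall L, (L0 <= L)%nat -> forall x a b Y,
    a <= b -> b - a <= d1 -> evolves B g sig m x a b ->
    (forall t, a <= t <= b -> x t (0, 0)%Z = 0) ->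
    (forall t, a <= t <= b -> mass_sum L (x t) <= Y) ->
    integral (fun t => grad_sum L (x t)) a b <= Y ->
    integral (fun t => x t (k1, k2) ^ 2) a b <=
      eta * Y + 80 / IZR m ^ 2 * (integral (fun t => line L (x t) k1) a b
                                  + integral (fun t => line L (swap (x t)) k2) a b).
Proof.
  intros Hg Hd1 Heta Hk1 Hk2.
  assert (Hm2 : 0 <= 80 / IZR m ^ 2).
  { destruct (Z.eq_dec m 0) as [->|Hm].
    - unfold Rdiv; rewrite pow_i, Rinv_0 by lia; lra.
    - apply Rlt_le, Rdiv_lt_0_compat; [lra|]; apply pow2_gt_0; now apply eq_IZR_contrapositive. }
  assert (Hln : forall L (x : R -> mode -> R) a b k, a <= b ->
     (forall l, cont_on a b (fun t => x t l)) -> 0 <= integral (fun t => line L (x t) k) a b).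
  { intros L x a b k Hab Hc; apply int_nonneg; auto; [unfold line; cont_tac; apply Hc|].
    intros; apply line_nonneg. }
  destruct (Z.eq_dec k1 0) as [E1|N1]; [destruct (Z.eq_dec k2 0) as [E2|N2]|].
  - subst; exists 0, 0%nat; intros B HB L HL x a b Y Hab Hd He Hz HY HG.
    assert (Hco := evolves_cont _ _ _ _ _ _ _ He).
    assert (Hco' := evolves_cont _ _ _ _ _ _ _ (evolves_swap _ _ _ _ _ _ _ He)).
    apply Rle_trans with (integral (fun _ => 0) a b).
    + apply int_le; auto; [cont_tac; apply Hco|cont_tac|].
      intros t Ht; rewrite Hz by assumption; lra.
    + rewrite int_const, Rmult_0_r.
      assert (0 <= Y) by (apply Rle_trans with (2 := HY a ltac:(lra)); apply mass_sum_nonneg).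
      apply Rplus_le_le_0_compat; [apply Rmult_le_pos; lra|].
      apply Rmult_le_pos; [assumption|]; apply Rplus_le_le_0_compat;
        [apply Hln|apply (Hln L (fun t => swap (x t)))]; auto.
  - destruct (low_mode_column g d1 eta (swap sig) m k2 k1 Hg Hd1 Heta N2 Hk2 Hk1) as (B0 & L0 & H).
    exists B0, L0; intros B HB L HL x a b Y Hab Hd He Hz HY HG.
    assert (Hco := evolves_cont _ _ _ _ _ _ _ He).
    assert (H' := H (- B) ltac:(rewrite Rabs_Ropp; assumption) L HL (fun t => swap (x t)) a b Y Hab Hd
      (evolves_swap _ _ _ _ _ _ _ He)
      ltac:(intros; cbv beta; rewrite mass_sum_swap; auto)).
    rewrite (int_ext a b _ (fun t => grad_sum L (x t))) in H' by (intros; apply grad_sum_swap).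
    specialize (H' HG).
    apply Rle_trans with (1 := H'); apply Rplus_le_compat_l, Rmult_le_compat_l; [assumption|].
    assert (H1 := Hln L x a b k1 Hab Hco); lra.
  - destruct (low_mode_column g d1 eta sig m k1 k2 Hg Hd1 Heta N1 Hk1 Hk2) as (B0 & L0 & H).
    exists B0, L0; intros B HB L HL x a b Y Hab Hd He Hz HY HG.
    assert (Hco' := evolves_cont _ _ _ _ _ _ _ (evolves_swap _ _ _ _ _ _ _ He)).
    apply Rle_trans with (1 := H B HB L HL x a b Y Hab Hd He HY HG).
    apply Rplus_le_compat_l, Rmult_le_compat_l; [assumption|].
    assert (H1 := Hln L (fun t => swap (x t)) a b k2 Hab Hco'); lra.
Qed.

Lemma uniform_thresholds {T : Type} (l : list T) (Q : T -> R -> nat -> Prop) :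
  (forall k, In k l -> exists B0 L0, forall B, B0 <= Rabs B -> forall L, (L0 <= L)%nat -> Q k B L) ->
  exists B0 L0, forall k, In k l -> forall B, B0 <= Rabs B -> forall L, (L0 <= L)%nat -> Q k B L.
Proof.
  induction l as [|k l IH]; intros H; [exists 0, 0%nat; intros ? []|].
  destruct (H k) as (B1 & L1 & H1); [now left|].
  destruct IH as (B2 & L2 & H2); [intros; apply H; now right|].
  exists (Rmax B1 B2), (Nat.max L1 L2); intros k' [<-|Hk] B HB L HL.
  - apply H1; [apply Rle_trans with (2 := HB), Rmax_l|lia].
  - apply H2; auto; [apply Rle_trans with (2 := HB), Rmax_r|lia].
Qed.

Lemma mass_low_high (h m L : nat) (y : mode -> R) :
  (0 < m)%nat -> (h <= L)%nat -> (m <= 2 * h + 1)%nat ->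
  mass_sum L y <= mass_sum h y + 4 / INR m ^ 2 * grad_sum L y.
Proof.
  intros Hm HL Hh; assert (HmR : 0 < INR m) by now apply lt_0_INR.
  set (lo := fun k : mode => if in_dec mode_eq_dec k (box h) then y k ^ 2 else 0).
  apply Rle_trans with (lsum (box L) (fun k => lo k + 4 / INR m ^ 2 * (sq k * y k ^ 2))).
  - apply lsum_le; intros k _; unfold lo.
    assert (Hy := pow2_ge_0 (y k)); assert (Hs := sq_nonneg k).
    assert (Hm2 : 0 < 4 / INR m ^ 2) by (apply Rdiv_lt_0_compat; nra).
    assert (Hsy : 0 <= sq k * y k ^ 2) by now apply Rmult_le_pos.
    destruct (in_dec mode_eq_dec k (box h)) as [|Hout]; [nra|].
    assert (Hk : INR m ^ 2 / 4 <= sq k).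
    { assert (E : forall a : Z, (Z.of_nat h < Z.abs a)%Z -> INR m ^ 2 / 4 <= IZR a ^ 2).
      { intros a Ha; rewrite <- (pow2_abs (IZR a)), <- abs_IZR.
        assert (H : INR m <= 2 * IZR (Z.abs a))
          by (rewrite INR_IZR_INZ, <- mult_IZR; apply IZR_le; lia).
        assert (INR m * INR m <= (2 * IZR (Z.abs a)) * (2 * IZR (Z.abs a)))
          by (apply Rmult_le_compat; lra).
        lra. }
      rewrite in_box in Hout; unfold sq.
      assert (H1 := pow2_ge_0 (IZR (fst k))); assert (H2 := pow2_ge_0 (IZR (snd k))).
      destruct (Z_lt_le_dec (Z.of_nat h) (Z.abs (fst k))) as [H|H];
        [specialize (E _ H); lra|].
      specialize (E (snd k) ltac:(lia)); lra. }
    rewrite Rplus_0_l.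
    apply Rle_trans with (4 / INR m ^ 2 * (INR m ^ 2 / 4 * y k ^ 2)); [apply Req_le; field; lra|].
    apply Rmult_le_compat_l; [lra|]; now apply Rmult_le_compat_r.
  - rewrite lsum_plus, lsum_scal; apply Rplus_le_compat_r.
    unfold mass_sum; rewrite (lsum_ext (box h) _ lo).
    + apply Req_le, lsum_supp; try apply NoDup_box.
      intros k; unfold lo; destruct (in_dec mode_eq_dec k (box h)) as [Hi|]; [|tauto].
      intros _; rewrite !in_box in *; lia.
    + intros k Hk; unfold lo; destruct (in_dec mode_eq_dec k (box h)); tauto.
Qed.

Lemma mass_le_dissipation (g d1 eta : R) (sig : mode -> R) (m : nat) :
  0 <= g -> 0 <= d1 -> 0 < eta -> (0 < m)%nat ->
  exists B0 : R, exists L0 : nat,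
  forall B, B0 <= Rabs B -> forall L, (L0 <= L)%nat -> forall x a b Y,
    a <= b -> b - a <= d1 -> evolves B g sig (Z.of_nat m) x a b ->
    (forall t, a <= t <= b -> x t (0, 0)%Z = 0) ->
    (forall t, a <= t <= b -> mass_sum L (x t) <= Y) ->
    integral (fun t => grad_sum L (x t)) a b <= Y ->
    integral (fun t => mass_sum L (x t)) a b <= (eta + 484 / INR m) * Y.
Proof.
  intros Hg Hd1 Heta Hm; assert (HmR : 1 <= INR m) by (apply (le_INR 1); lia).
  set (h := (m / 2)%nat).
  assert (Hh : (2 * h <= m <= 2 * h + 1)%nat).
  { unfold h; assert (H := Nat.div_mod_eq m 2); assert (H' := Nat.mod_upper_bound m 2 ltac:(lia)); lia. }
  set (n := INR (2 * h + 1)).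
  assert (Hn1 : 1 <= n) by (apply (le_INR 1); lia).
  assert (Hn2 : n <= 3 * INR m).
  { unfold n; replace 3 with (INR 3) by (cbn; ring); rewrite <- mult_INR; apply le_INR; lia. }
  set (eta' := eta / n ^ 2).
  assert (Heta' : 0 < eta') by (apply Rdiv_lt_0_compat; nra).
  destruct (uniform_thresholds (box h) (fun k B L => forall x a b Y,
    a <= b -> b - a <= d1 -> evolves B g sig (Z.of_nat m) x a b ->
    (forall t, a <= t <= b -> x t (0, 0)%Z = 0) ->
    (forall t, a <= t <= b -> mass_sum L (x t) <= Y) ->
    integral (fun t => grad_sum L (x t)) a b <= Y ->
    integral (fun t => x t k ^ 2) a b <=
      eta' * Y + 80 / INR m ^ 2 * (integral (fun t => line L (x t) (fst k)) a b
                                  + integral (fun t => line L (swap (x t)) (snd k)) a b)))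
    as (B0 & L0 & Hlow).
  { intros [k1 k2] Hk; apply in_box in Hk; cbn [fst snd] in *.
    rewrite INR_IZR_INZ; apply low_mode; auto; lia. }
  exists B0, (Nat.max L0 h); intros B HB L HL x a b Y Hab Hd He Hz HY HG.
  assert (Hc := evolves_cont _ _ _ _ _ _ _ He).
  assert (Hcs := evolves_cont _ _ _ _ _ _ _ (evolves_swap _ _ _ _ _ _ _ He)).
  assert (HcG : cont_on a b (fun t => grad_sum L (x t))) by (unfold grad_sum; cont_tac; apply Hc).
  assert (Hcm : forall L, cont_on a b (fun t => mass_sum L (x t)))
    by (intros; unfold mass_sum; cont_tac; apply Hc).
  assert (Hcl : forall k, cont_on a b (fun t => line L (x t) k))
    by (intros; unfold line; cont_tac; apply Hc).
  assert (Hcls : forall k, cont_on a b (fun t => line L (swap (x t)) k))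
    by (intros; unfold line; cont_tac; apply Hcs).
  apply Rle_trans with
    (integral (fun t => mass_sum h (x t) + 4 / INR m ^ 2 * grad_sum L (x t)) a b).
  { apply int_le; auto; [cont_tac; auto|]; intros; apply mass_low_high; lia. }
  rewrite int_plus, int_scal by (auto; cont_tac; auto).
  assert (Hlines : lsum (zrange h) (fun k => integral (fun t => line L (x t) k) a b) <= Y).
  { rewrite <- (int_lsum a b (zrange h) (fun t k => line L (x t) k)) by auto.
    apply Rle_trans with (2 := HG); apply int_le; auto; [cont_tac; auto|].
    intros; apply lines_le_grad; lia. }
  assert (Hlines' : lsum (zrange h) (fun k => integral (fun t => line L (swap (x t)) k) a b) <= Y).
  { rewrite <- (int_lsum a b (zrange h) (fun t k => line L (swap (x t)) k)) by auto.
    apply Rle_trans with (2 := HG); apply int_le; auto; [cont_tac; auto|].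
    intros; rewrite <- grad_sum_swap; apply lines_le_grad; lia. }
  assert (Hsum : integral (fun t => mass_sum h (x t)) a b <= eta * Y + 480 / INR m * Y).
  { unfold mass_sum; rewrite (int_lsum a b (box h) (fun t k => x t k ^ 2))
      by (auto; intros; cont_tac; auto).
    apply Rle_trans with (lsum (box h) (fun k => eta' * Y +
      80 / INR m ^ 2 * (integral (fun t => line L (x t) (fst k)) a b
                        + integral (fun t => line L (swap (x t)) (snd k)) a b))).
    - apply lsum_le; intros k Hk; apply (Hlow k Hk B HB L); auto; lia.
    - rewrite lsum_plus, lsum_const, lsum_scal, lsum_plus; unfold box, mode.
      rewrite !lsum_prod, length_prod, !length_zrange; cbn [fst snd].
      assert (Hconst : forall f : Z -> R,
        lsum (zrange h) (fun i => lsum (zrange h) (fun _ => f i)) = n * lsum (zrange h) f).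
      { intros f; rewrite <- lsum_scal; apply lsum_ext; intros i _.
        now rewrite lsum_const, length_zrange. }
      rewrite (Hconst (fun k => integral (fun t => line L (x t) k) a b)).
      rewrite lsum_const, length_zrange, mult_INR; fold n.
      set (l1 := lsum _ _) in *; set (l2 := lsum _ _) in *.
      apply Rplus_le_compat.
      + unfold eta'; apply Req_le; field; lra.
      + assert (HY0 : 0 <= Y)
          by (apply Rle_trans with (2 := HY a ltac:(lra)); apply mass_sum_nonneg).
        apply Rle_trans with (80 / INR m ^ 2 * (3 * INR m * (2 * Y)));
          [|apply Req_le; field; lra].
        apply Rmult_le_compat_l; [apply Rlt_le, Rdiv_lt_0_compat; nra|].
        rewrite <- Rmult_plus_distr_l.
        apply Rle_trans with (n * (2 * Y)); [apply Rmult_le_compat_l; lra|].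
        apply Rmult_le_compat_r; lra. }
  assert (Hhigh : 4 / INR m ^ 2 * integral (fun t => grad_sum L (x t)) a b <= 4 / INR m * Y).
  { assert (HY0 : 0 <= Y)
      by (apply Rle_trans with (2 := HY a ltac:(lra)); apply mass_sum_nonneg).
    apply Rle_trans with (4 / INR m ^ 2 * Y).
    - apply Rmult_le_compat_l; [apply Rlt_le, Rdiv_lt_0_compat; nra|assumption].
    - apply Rmult_le_compat_r; [assumption|]; apply Rmult_le_compat_l; [lra|].
      apply Rinv_le_contravar; nra. }
  replace ((eta + 484 / INR m) * Y) with (eta * Y + 480 / INR m * Y + 4 / INR m * Y) by (field; lra).
  lra.
Qed.

(** * Contraction of the energy *)

Lemma energy_step (B g Cst : R) (sig : mode -> R) (m L : nat) (x : R -> mode -> R) (a b : R) :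
  0 <= g -> (forall k, sq k <= sig k) -> (0 < L)%nat -> (2 * m <= L)%nat ->
  evolves B g sig (Z.of_nat m) x a b -> a <= b ->
  (forall t, a <= t <= b -> forall N, lsum (box N) (fun k => (1 + sq k) * x t k ^ 2) <= Cst) ->
  mass_sum L (x b) + 2 * g * integral (fun t => grad_sum L (x t)) a b
    <= mass_sum L (x a) + (b - a) * (64 * Rabs B * Cst / INR L).
Proof.
  intros Hg Hsig HL HmL He Hab HC.
  assert (HL' : 0 < INR L) by (apply lt_0_INR; lia).
  assert (Hc := evolves_cont _ _ _ _ _ _ _ He).
  set (dE := fun t => lsum (box L) (fun k =>
    (B * adv (Z.of_nat m) (x t) k - g * (sig k * x t k)) * x t k
    + x t k * (B * adv (Z.of_nat m) (x t) k - g * (sig k * x t k)))).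
  assert (HE : forall t, a <= t <= b -> is_derive (fun s => lsum (box L) (fun k => x s k * x s k)) t (dE t)).
  { intros t Ht; apply (is_derive_lsum (box L) (fun s k => x s k * x s k)).
    intros k; apply (is_derive_prod (fun s => x s k) (fun s => x s k)); now apply He. }
  assert (HcdE : cont_on a b dE).
  { unfold dE; cont_tac; try apply Hc; apply cont_adv; apply Hc. }
  assert (HcG : cont_on a b (fun t => grad_sum L (x t))) by (unfold grad_sum; cont_tac; apply Hc).
  assert (Hm : forall t, lsum (box L) (fun k => x t k * x t k) = mass_sum L (x t))
    by (intros t; apply lsum_ext; intros; ring).
  assert (Hint := int_derive a b _ dE Hab HE HcdE); cbv beta in Hint; rewrite !Hm in Hint.
  set (ze := 64 * Rabs B * Cst / INR L).
  assert (Hle : integral dE a b <= integral (fun t => - (2 * g) * grad_sum L (x t) + ze) a b).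
  { apply int_le; auto; [cont_tac|].
    intros t Ht.
    assert (Hfl := flux_bound L m (x t) Cst HL HmL (HC t Ht)).
    set (fl := lsum (box L) (fun k => x t k * adv (Z.of_nat m) (x t) k)) in *.
    assert (HD : grad_sum L (x t) <= lsum (box L) (fun k => sig k * x t k ^ 2)).
    { apply lsum_le; intros k _; apply Rmult_le_compat_r; [apply pow2_ge_0|apply Hsig]. }
    set (D := lsum (box L) (fun k => sig k * x t k ^ 2)) in *.
    assert (E : dE t = 2 * B * fl - 2 * g * D).
    { unfold dE, fl, D; rewrite <- !lsum_scal, <- lsum_minus; apply lsum_ext; intros; ring. }
    assert (Hb : 2 * B * fl <= ze).
    { apply Rle_trans with (1 := Rle_abs _); rewrite !Rabs_mult, (Rabs_pos_eq 2) by lra.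
      replace ze with (2 * Rabs B * (32 * Cst / INR L)) by (unfold ze; field; lra).
      apply Rmult_le_compat_l; [|assumption].
      assert (H := Rabs_pos B); lra. }
    rewrite E; nra. }
  rewrite int_plus, int_scal, int_const in Hle by (auto; cont_tac).
  lra.
Qed.

Lemma evolves_sub (B g : R) (sig : mode -> R) (m : Z) (x : R -> mode -> R) (a b a' b' : R) :
  evolves B g sig m x a b -> a <= a' -> b' <= b -> evolves B g sig m x a' b'.
Proof. intros H Ha Hb t Ht; apply H; lra. Qed.

Lemma quarter_contraction (g d0 d1 : R) (sig : mode -> R) (m : nat) :
  0 < g -> 0 < d0 -> 0 <= d1 -> (0 < m)%nat -> (forall k, sq k <= sig k) ->
  484 / INR m * (1 + / (2 * g)) <= d0 / 8 ->
  exists B0 : R, forall B, B0 <= Rabs B -> forall x a b Cst,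
    d0 <= b - a <= d1 -> evolves B g sig (Z.of_nat m) x a b ->
    (forall t, a <= t <= b -> x t (0, 0)%Z = 0) ->
    (forall t, a <= t <= b -> forall N, lsum (box N) (fun k => (1 + sq k) * x t k ^ 2) <= Cst) ->
    forall mu, 0 < mu -> exists L1, forall L, (L1 <= L)%nat ->
      mass_sum L (x b) <= / 4 * mass_sum L (x a) + mu.
Proof.
  intros Hg Hd0 Hd1 Hm Hsig Hmbig.
  assert (Hg' : 0 < / (2 * g)) by (apply Rinv_0_lt_compat; lra).
  set (eta := d0 / 8 / (1 + / (2 * g))).
  assert (Heta : 0 < eta) by (repeat apply Rdiv_lt_0_compat; lra).
  destruct (mass_le_dissipation g d1 eta sig m) as (B0 & L0 & Hmain); try lra; try assumption.
  exists B0; intros B HB x a b Cst Hab He Hz HC mu Hmu.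
  assert (HC0 : 0 <= Cst).
  { apply Rle_trans with (2 := HC a ltac:(lra) 0%nat); apply lsum_nonneg; intros k _.
    apply Rmult_le_pos; [assert (H := sq_nonneg k); lra|apply pow2_ge_0]. }
  destruct (INR_unbounded (128 * Rabs B * Cst * d1 / mu)) as [L2 HL2].
  exists (Nat.max L0 (L2 + 2 * m)); intros L HL.
  assert (HLpos : (0 < L)%nat) by lia.
  assert (HL' : 0 < INR L) by (apply lt_0_INR; lia).
  set (ze := 64 * Rabs B * Cst / INR L).
  assert (Hze : 0 <= ze).
  { apply Rdiv_le_0_compat; [|lra]; repeat apply Rmult_le_pos; try lra; apply Rabs_pos. }
  assert (Hzed : 2 * (d1 * ze) <= mu).
  { unfold ze; replace (2 * (d1 * (64 * Rabs B * Cst / INR L)))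
      with ((128 * Rabs B * Cst * d1) / INR L) by (field; lra).
    apply Rle_div_l; [lra|].
    assert (H : 128 * Rabs B * Cst * d1 / mu <= INR L)
      by (apply Rle_trans with (INR L2); [lra|apply le_INR; lia]).
    apply Rle_div_l in H; [lra|assumption]. }
  assert (Hstep : forall s t, a <= s -> s <= t -> t <= b ->
    mass_sum L (x t) + 2 * g * integral (fun t => grad_sum L (x t)) s t
      <= mass_sum L (x s) + d1 * ze).
  { intros s t Hs Hst Ht.
    assert (H := energy_step B g Cst sig m L x s t ltac:(lra) Hsig HLpos ltac:(lia)
      (evolves_sub _ _ _ _ _ _ _ _ _ He Hs Ht) Hst
      ltac:(intros; apply HC; lra)).
    fold ze in H; apply Rle_trans with (1 := H); apply Rplus_le_compat_l.
    apply Rmult_le_compat_r; lra. }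
  assert (Hgi : forall s t, a <= s -> s <= t -> t <= b ->
    0 <= integral (fun t => grad_sum L (x t)) s t).
  { intros s t Hs Hst Ht; apply int_nonneg; auto.
    - assert (Hc := evolves_cont _ _ _ _ _ _ _ (evolves_sub _ _ _ _ _ _ _ _ _ He Hs Ht)).
      unfold grad_sum; cont_tac; apply Hc.
    - intros; apply grad_sum_nonneg. }
  set (Y := mass_sum L (x a) + d1 * ze).
  set (IG := integral (fun t => grad_sum L (x t)) a b).
  assert (HIG : 2 * g * IG <= Y).
  { assert (H := Hstep a b ltac:(lra) ltac:(lra) ltac:(lra)); fold IG Y in H.
    assert (H' := mass_sum_nonneg L (x b)); lra. }
  assert (HY0 : 0 <= Y).
  { unfold Y; assert (H := mass_sum_nonneg L (x a)).
    assert (0 <= d1 * ze) by now apply Rmult_le_pos. lra. }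
  set (Y' := (1 + / (2 * g)) * Y).
  assert (HYm : forall t, a <= t <= b -> mass_sum L (x t) <= Y').
  { intros t Ht; assert (H := Hstep a t ltac:(lra) ltac:(lra) ltac:(lra)); fold Y in H.
    assert (H' := Hgi a t ltac:(lra) ltac:(lra) ltac:(lra)).
    assert (0 <= 2 * g * integral (fun t => grad_sum L (x t)) a t)
      by (apply Rmult_le_pos; lra).
    assert (0 <= / (2 * g) * Y) by (apply Rmult_le_pos; lra).
    unfold Y'; lra. }
  assert (HIG' : IG <= Y').
  { apply Rle_trans with (/ (2 * g) * Y); [|unfold Y'; lra].
    apply Rle_trans with (/ (2 * g) * (2 * g * IG)); [apply Req_le; field; lra|].
    apply Rmult_le_compat_l; lra. }
  assert (HM := Hmain B HB L ltac:(lia) x a b Y' ltac:(lra) ltac:(lra) He Hz HYm HIG').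
  assert (HM' : (eta + 484 / INR m) * Y' <= d0 / 4 * Y).
  { unfold Y'; rewrite <- Rmult_assoc; apply Rmult_le_compat_r; [assumption|].
    replace ((eta + 484 / INR m) * (1 + / (2 * g)))
      with (d0 / 8 + 484 / INR m * (1 + / (2 * g))); [lra|].
    assert (0 < INR m) by (apply lt_0_INR; lia); unfold eta; field; lra. }
  set (q := mass_sum L (x b) - d1 * ze).
  assert (Hlow : (b - a) * q <= integral (fun t => mass_sum L (x t)) a b).
  { rewrite <- (int_const a b q); apply int_le; [lra|cont_tac| |].
    - assert (Hc := evolves_cont _ _ _ _ _ _ _ He); unfold mass_sum; cont_tac; apply Hc.
    - intros t Ht; assert (H := Hstep t b ltac:(lra) ltac:(lra) ltac:(lra)).
      assert (H' := Hgi t b ltac:(lra) ltac:(lra) ltac:(lra)).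
      assert (0 <= 2 * g * integral (fun t => grad_sum L (x t)) t b)
        by (apply Rmult_le_pos; lra).
      unfold q; lra. }
  assert (Hma := mass_sum_nonneg L (x a)).
  assert (Hq : q <= Y / 4).
  { destruct (Rle_lt_dec q 0) as [|Hq]; [lra|].
    assert (d0 * q <= (b - a) * q) by (apply Rmult_le_compat_r; lra).
    apply Rmult_le_reg_l with d0; lra. }
  unfold q, Y in Hq; lra.
Qed.

(** * From Fourier coefficients to the dissipation time *)

Lemma advect_cellular (A : R) (m : nat) (f : mode -> C) (k : mode) :
  fst (advect (cellular_hat A m) f k) = - (PI ^ 2 * A * adv (Z.of_nat m) (fun l => fst (f l)) k) /\
  snd (advect (cellular_hat A m) f k) = - (PI ^ 2 * A * adv (Z.of_nat m) (fun l => snd (f l)) k).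
Proof.
  unfold advect, cellular_hat; cbn [map fold_right fst snd].
  set (M := Z.of_nat m).
  replace (fst k - M * 1)%Z with (fst k - M)%Z by lia.
  replace (snd k - M * 1)%Z with (snd k - M)%Z by lia.
  replace (fst k - M * -1)%Z with (fst k + M)%Z by lia.
  replace (snd k - M * -1)%Z with (snd k + M)%Z by lia.
  unfold Cplus, Cmult, RtoC, adv; cbn [fst snd].
  rewrite !plus_IZR, !minus_IZR; split; field.
Qed.

Lemma sq_le_frac_symbol (alpha : R) (k : mode) : 1 <= alpha -> sq k <= frac_symbol alpha k.
Proof.
  intros Ha; unfold frac_symbol; fold (sq k); destruct k as [k1 k2]; cbn [fst snd].
  destruct (Z.eqb_spec k1 0) as [->|N1]; [destruct (Z.eqb_spec k2 0) as [->|N2]|];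
    cbn [andb]; [unfold sq; cbn [fst snd]; lra| |].
  all: set (n := sq _).
  all: assert (Hn : 1 <= n).
  1: { unfold n, sq; cbn [fst snd]; rewrite <- (pow2_abs (IZR k2)), <- abs_IZR.
       assert (1 <= IZR (Z.abs k2)) by (apply IZR_le; lia); nra. }
  2: { unfold n, sq; cbn [fst snd]; rewrite <- (pow2_abs (IZR k1)), <- abs_IZR.
       assert (1 <= IZR (Z.abs k1)) by (apply IZR_le; lia).
       assert (Hk2 := pow2_ge_0 (IZR k2)); nra. }
  all: assert (HPI : 1 <= PI ^ 2) by (assert (H := PI2_1); nra).
  all: assert (Hb : n <= 4 * PI ^ 2 * n) by nra.
  all: apply Rle_trans with (1 := Hb).
  all: rewrite <- (Rpower_1 (4 * PI ^ 2 * n)) at 1 by lra.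
  all: apply Rle_Rpower; lra.
Qed.

Lemma Cmod_sqr (z : C) : Cmod z ^ 2 = fst z ^ 2 + snd z ^ 2.
Proof.
  unfold Cmod; rewrite <- Rsqr_pow2; apply Rsqr_sqrt.
  assert (H1 := pow2_ge_0 (fst z)); assert (H2 := pow2_ge_0 (snd z)); lra.
Qed.

Lemma boxsum_le_tsum (g : mode -> R) (r : R) :
  Rbar_le (tsum g) r -> forall N, boxsum N g <= r.
Proof.
  intros H N; destruct (Lub_Rbar_correct (fun r => exists N, r = boxsum N g)) as [Hub _].
  exact (Rbar_le_trans _ _ _ (Hub (boxsum N g) (ex_intro _ N eq_refl)) H).
Qed.

Lemma tsum_le (g : mode -> R) (r : R) : (forall N, boxsum N g <= r) -> Rbar_le (tsum g) r.
Proof.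
  intros H; destruct (Lub_Rbar_correct (fun r => exists N, r = boxsum N g)) as [_ Hlub].
  apply Hlub; intros y [N ->]; apply H.
Qed.

Definition re_part (f : mode -> C) : mode -> R := fun k => fst (f k).
Definition im_part (f : mode -> C) : mode -> R := fun k => snd (f k).

Lemma boxsum_norm2 (N : nat) (f : mode -> C) :
  boxsum N (fun k => Cmod (f k) ^ 2) = mass_sum N (re_part f) + mass_sum N (im_part f).
Proof.
  rewrite boxsum_lsum; unfold mass_sum; rewrite <- lsum_plus; apply lsum_ext; intros k _.
  apply Cmod_sqr.
Qed.

Lemma solution_evolves (A alpha gamma s a b : R) (m : nat) (th0 : mode -> C) (theta : R -> mode -> C) :
  is_solution (cellular_hat A m) alpha gamma s th0 theta -> s < a ->
  evolves (PI ^ 2 * A) gamma (frac_symbol alpha) (Z.of_nat m) (fun t => re_part (theta t)) a b /\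
  evolves (PI ^ 2 * A) gamma (frac_symbol alpha) (Z.of_nat m) (fun t => im_part (theta t)) a b.
Proof.
  intros (_ & _ & _ & Heq) Ha; split; intros t Ht k;
    destruct (Heq t ltac:(lra) k) as [H1 H2];
    destruct (advect_cellular A m (theta t) k) as [E1 E2].
  - apply is_derive_Reals in H1; unfold re_part.
    match goal with |- is_derive _ _ ?d => match type of H1 with is_derive _ _ ?d' =>
      replace d with d'; [exact H1|] end end.
    unfold Copp, Cplus; cbn [fst snd]; rewrite E1.
    unfold Cmult, RtoC; cbn [fst snd]; ring.
  - apply is_derive_Reals in H2; unfold im_part.
    match goal with |- is_derive _ _ ?d => match type of H2 with is_derive _ _ ?d' =>
      replace d with d'; [exact H2|] end end.
    unfold Copp, Cplus; cbn [fst snd]; rewrite E2.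
    unfold Cmult, RtoC; cbn [fst snd]; ring.
Qed.

Lemma zero_mode_vanishes (B g : R) (sig : mode -> R) (m : Z) (x : R -> mode -> R) (s : R) :
  (forall a b, s < a -> evolves B g sig m x a b) -> sig (0, 0)%Z = 0 ->
  (forall eps, 0 < eps -> exists delta, 0 < delta /\
     forall t, s < t < s + delta -> x t (0, 0)%Z ^ 2 <= eps) ->
  forall t, s < t -> x t (0, 0)%Z = 0.
Proof.
  intros He Hsig Hlim t Ht.
  assert (Hconst : forall r, s < r <= t -> x t (0, 0)%Z = x r (0, 0)%Z).
  { intros r Hr; assert (H := int_derive r t (fun u => x u (0, 0)%Z) (fun _ => 0) ltac:(lra)).
    rewrite int_const, Rmult_0_r in H.
    enough (0 = x t (0, 0)%Z - x r (0, 0)%Z) by lra.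
    apply H; [|apply cont_const].
    intros u Hu; assert (Hd := He r t ltac:(lra) u Hu (0, 0)%Z).
    rewrite Hsig in Hd; unfold adv in Hd; cbn [fst snd] in Hd.
    match type of Hd with is_derive _ _ ?d => replace d with 0 in Hd by ring end.
    exact Hd. }
  assert (Hsmall : forall eps, 0 < eps -> x t (0, 0)%Z ^ 2 <= eps).
  { intros eps Heps; destruct (Hlim eps Heps) as (delta & Hd & H).
    set (r := Rmin t (s + delta / 2)).
    assert (Hr : s < r <= t /\ r < s + delta).
    { unfold r, Rmin; destruct (Rle_dec _ _); lra. }
    rewrite (Hconst r) by lra; apply H; lra. }
  assert (Hsq : x t (0, 0)%Z ^ 2 <= 0).
  { apply Rnot_lt_le; intros H; specialize (Hsmall (x t (0, 0)%Z ^ 2 / 2) ltac:(lra)); lra. }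
  nra.
Qed.

Lemma mass_perturb (L : nat) (y z : mode -> R) (mu : R) :
  0 < mu ->
  mass_sum L y <= (1 + mu) * mass_sum L z + (1 + / mu) * mass_sum L (fun k => y k - z k).
Proof.
  intros Hmu; unfold mass_sum; rewrite <- !lsum_scal, <- lsum_plus; apply lsum_le; intros k _.
  set (q := z k); set (d := y k - z k); replace (y k) with (q + d) by (unfold q, d; ring).
  assert (H : 0 <= (mu * q - d) ^ 2 / mu) by (apply Rdiv_le_0_compat; [apply pow2_ge_0|lra]).
  replace ((mu * q - d) ^ 2 / mu) with (mu * q ^ 2 - 2 * q * d + / mu * d ^ 2) in H by (field; lra).
  lra.
Qed.

Lemma cellular_half_contracting (gamma alpha eps : R) (m : nat) :
  0 < gamma -> 1 <= alpha -> 0 < eps -> (0 < m)%nat ->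
  484 / INR m * (1 + / (2 * gamma)) <= eps / 16 ->
  exists B0 : R, forall A, B0 <= PI ^ 2 * A ->
    half_contracting (cellular_hat A m) alpha gamma eps.
Proof.
  intros Hg Ha Heps Hm Hbig.
  destruct (quarter_contraction gamma (eps / 2) eps (frac_symbol alpha) m)
    as [B0 HB0]; try lra; try assumption.
  { intros k; now apply sq_le_frac_symbol. }
  exists B0; intros A HA s _ th0 theta (Hfin & Hz0 & _) Hsol.
  assert (HAabs : B0 <= Rabs (PI ^ 2 * A)) by (apply Rle_trans with (1 := HA); apply Rle_abs).
  assert (Hsol' := Hsol); destruct Hsol' as (_ & Hcont & Hreg & _).
  assert (Hev := fun a b => solution_evolves A alpha gamma s a b m th0 theta Hsol).
  destruct (norm2 th0) as [E0| |] eqn:HE0; try discriminate Hfin.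
  assert (Hth0 : forall L, mass_sum L (re_part th0) + mass_sum L (im_part th0) <= E0).
  { intros L; rewrite <- boxsum_norm2; apply boxsum_le_tsum.
    change (Rbar_le (norm2 th0) E0); rewrite HE0; apply Rle_refl. }
  assert (HE0p : 0 <= E0).
  { assert (H := Hth0 0%nat); assert (H1 := mass_sum_nonneg 0 (re_part th0)).
    assert (H2 := mass_sum_nonneg 0 (im_part th0)); lra. }
  assert (Hdiff : forall e, 0 < e -> exists delta, 0 < delta /\ forall t, s < t < s + delta ->
    forall L, mass_sum L (fun k => re_part (theta t) k - re_part th0 k)
              + mass_sum L (fun k => im_part (theta t) k - im_part th0 k) <= e).
  { intros e He; destruct (Hcont e He) as (delta & Hd & H); exists delta; split; [assumption|].
    intros t Ht L; specialize (H t Ht).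
    assert (H' := boxsum_le_tsum _ _ H L); rewrite boxsum_norm2 in H'.
    exact H'. }
  assert (Hbox0 : forall y : mode -> R, y (0, 0)%Z ^ 2 <= mass_sum 0 y).
  { intros y; apply (lsum_elem_le (box 0) (fun k => y k ^ 2)); [intros; apply pow2_ge_0|].
    apply in_box; cbn; lia. }
  assert (Hzero : forall t, s < t ->
    re_part (theta t) (0, 0)%Z = 0 /\ im_part (theta t) (0, 0)%Z = 0).
  { intros t Ht; split.
    - apply (zero_mode_vanishes (PI ^ 2 * A) gamma (frac_symbol alpha) (Z.of_nat m)
        (fun t => re_part (theta t)) s); auto; [intros; now apply Hev|].
      intros e He; destruct (Hdiff e He) as (delta & Hd & H); exists delta; split; [assumption|].
      intros r Hr; specialize (H r Hr 0%nat).
      assert (H1 := Hbox0 (fun k => re_part (theta r) k - re_part th0 k)); cbv beta in H1.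
      assert (H2 := mass_sum_nonneg 0 (fun k => im_part (theta r) k - im_part th0 k)).
      unfold re_part at 2 in H1; rewrite Hz0 in H1; cbn [fst RtoC] in H1; rewrite Rminus_0_r in H1.
      lra.
    - apply (zero_mode_vanishes (PI ^ 2 * A) gamma (frac_symbol alpha) (Z.of_nat m)
        (fun t => im_part (theta t)) s); auto; [intros; now apply Hev|].
      intros e He; destruct (Hdiff e He) as (delta & Hd & H); exists delta; split; [assumption|].
      intros r Hr; specialize (H r Hr 0%nat).
      assert (H1 := Hbox0 (fun k => im_part (theta r) k - im_part th0 k)); cbv beta in H1.
      assert (H2 := mass_sum_nonneg 0 (fun k => re_part (theta r) k - re_part th0 k)).
      unfold im_part at 2 in H1; rewrite Hz0 in H1; cbn [snd RtoC] in H1; rewrite Rminus_0_r in H1.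
      lra. }
  apply tsum_le; intros L0; rewrite boxsum_norm2.
  apply Rnot_lt_le; intros Hlt.
  set (b := s + eps) in *.
  set (nu := mass_sum L0 (re_part (theta b)) + mass_sum L0 (im_part (theta b)) - / 4 * E0).
  assert (Hnu : 0 < nu) by (unfold nu; lra).
  set (mu := nu / (E0 + 1)).
  assert (Hmu : 0 < mu) by (apply Rdiv_lt_0_compat; lra).
  assert (Hmu' : 0 < 1 + / mu) by (assert (H := Rinv_0_lt_compat mu Hmu); lra).
  destruct (Hdiff (nu / (1 + / mu)) ltac:(apply Rdiv_lt_0_compat; lra)) as (delta & Hd & Hdl).
  set (a := s + Rmin (eps / 2) (delta / 2)).
  assert (Hsa : s < a /\ a < s + delta /\ eps / 2 <= b - a <= eps).
  { unfold a, b, Rmin; destruct (Rle_dec _ _); lra. }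
  destruct Hsa as (Hsa & Had & Hab).
  destruct (Hreg a b Hsa ltac:(lra) 1%nat) as [Cst HCst].
  assert (Hh1 : forall t, a <= t <= b -> forall N,
    lsum (box N) (fun k => (1 + sq k) * re_part (theta t) k ^ 2) <= Cst /\
    lsum (box N) (fun k => (1 + sq k) * im_part (theta t) k ^ 2) <= Cst).
  { intros t Ht N; assert (H := boxsum_le_tsum _ _ (HCst t Ht) N); rewrite boxsum_lsum in H.
    split; apply Rle_trans with (2 := H); apply lsum_le; intros k _; rewrite pow_1, Cmod_sqr;
      unfold re_part, im_part; rewrite Rplus_assoc; fold (sq k); apply Rmult_le_compat_l;
      assert (Hs := sq_nonneg k); assert (H1 := pow2_ge_0 (fst (theta t k)));
      assert (H2 := pow2_ge_0 (snd (theta t k))); lra. }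
  destruct (HB0 _ HAabs (fun t => re_part (theta t)) a b Cst Hab (proj1 (Hev a b Hsa))
    ltac:(intros; apply Hzero; lra) ltac:(intros; now apply Hh1) (nu / 8) ltac:(lra)) as [L1 HL1].
  destruct (HB0 _ HAabs (fun t => im_part (theta t)) a b Cst Hab (proj2 (Hev a b Hsa))
    ltac:(intros; apply Hzero; lra) ltac:(intros; now apply Hh1) (nu / 8) ltac:(lra)) as [L2 HL2].
  set (L := (L0 + L1 + L2)%nat).
  specialize (HL1 L ltac:(unfold L; lia)); specialize (HL2 L ltac:(unfold L; lia)).
  assert (Hmono : forall y : mode -> R, mass_sum L0 y <= mass_sum L y).
  { intros y; apply lsum_box_mono; [unfold L; lia|intros; apply pow2_ge_0]. }
  assert (M1 := Hmono (re_part (theta b))); assert (M2 := Hmono (im_part (theta b))).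
  assert (P1 := mass_perturb L (re_part (theta a)) (re_part th0) mu Hmu).
  assert (P2 := mass_perturb L (im_part (theta a)) (im_part th0) mu Hmu).
  assert (Hd1 := Hdl a ltac:(lra) L).
  assert (H0 := Hth0 L).
  assert (Q1 : (1 + mu) * (mass_sum L (re_part th0) + mass_sum L (im_part th0)) <= E0 + nu).
  { apply Rle_trans with ((1 + mu) * E0); [apply Rmult_le_compat_l; lra|].
    enough (mu * E0 <= nu) by lra.
    apply Rle_trans with (mu * (E0 + 1)); [apply Rmult_le_compat_l; lra|].
    apply Req_le; unfold mu; field; lra. }
  assert (Q2 : (1 + / mu) * (mass_sum L (fun k => re_part (theta a) k - re_part th0 k)
              + mass_sum L (fun k => im_part (theta a) k - im_part th0 k)) <= nu).
  { apply Rle_trans with ((1 + / mu) * (nu / (1 + / mu))).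
    - apply Rmult_le_compat_l; lra.
    - apply Req_le; field; split; lra. }
  unfold nu in *; lra.
Qed.

Theorem theorem3p1 (gamma alpha : R) (hgamma : 0 < gamma) (halpha : 1 <= alpha) :
  forall eps : R, 0 < eps ->
  exists m0 : R, 0 < m0 /\
    forall m : nat, m0 <= INR m ->
    exists A0 : R, 0 < A0 /\
      forall A : R, A0 <= A ->
        Rbar_le (tau_star (cellular_hat A m) alpha gamma) eps.
Proof.
  intros eps Heps.
  assert (Hg : 0 < / (2 * gamma)) by (apply Rinv_0_lt_compat; lra).
  set (m0 := 484 * (1 + / (2 * gamma)) / (eps / 16)).
  assert (Hm0 : 0 < m0) by (apply Rdiv_lt_0_compat; lra).
  exists m0; split; [assumption|]; intros m Hm.
  assert (Hm1 : 0 < INR m) by lra.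
  destruct (cellular_half_contracting gamma alpha eps m) as [B0 HB0]; auto.
  - now apply INR_lt.
  - replace (484 / INR m * (1 + / (2 * gamma)))
      with (484 * (1 + / (2 * gamma)) / INR m) by (field; lra).
    apply Rle_div_l; [assumption|]; apply Rle_div_l in Hm; lra.
  - exists (Rmax 1 B0); split; [apply Rlt_le_trans with (2 := Rmax_l _ _); lra|].
    intros A HA.
    assert (HA1 : 1 <= A) by (apply Rle_trans with (2 := HA); apply Rmax_l).
    assert (HAB : B0 <= A) by (apply Rle_trans with (2 := HA); apply Rmax_r).
    assert (HPI : 1 <= PI ^ 2) by (assert (H := PI2_1); nra).
    destruct (Glb_Rbar_correct
      (fun t => 0 <= t /\ half_contracting (cellular_hat A m) alpha gamma t)) as [Hlb _].
    apply Hlb; split; [lra|]; apply HB0; nra.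
Qed.
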